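(* Let $k\geq 2$. The complement $\exp_k S^1\setminus\exp_{k-2}S^1$ has the homotopy type of the complement in $S^3$ of a $(k-1,k)$-torus knot.
   Context: For a topological space $X$ and $k\geq 1$, $\exp_k X$ is the set of nonempty subsets of $X$ of cardinality at most $k$, with the quotient topology from the map $X^k\to\exp_k X$, $(x_1,\ldots,x_k)\mapsto\{x_1\}\cup\cdots\cup\{x_k\}$; $\exp_0 X=\emptyset$. For $l\leq k$, $\exp_l X$ is regarded as a subspace of $\exp_k X$ via the natural inclusion sending a subset to itself. Thus $\exp_k S^1\setminus\exp_{k-2}S^1$ consists of the subsets of $S^1$ with exactly $k-1$ or $k$ elements. *)

(* Defs.v *)
From HB Require Import structures.
From mathcomp Require Import all_boot all_order all_algebra.
From mathcomp Require Import all_classical all_reals all_analysis.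

Set Implicit Arguments.
Unset Strict Implicit.
Unset Printing Implicit Defensive.

Import Order.TTheory GRing.Theory Num.Theory.
Import numFieldNormedType.Exports.
Local Open Scope classical_set_scope.
Local Open Scope ring_scope.

Definition finite_subsets (X : Type) (k : nat) : set (set X) :=
  [set A | A !=set0 /\ (A #<= `I_k)%card].
Arguments finite_subsets : clear implicits.

Definition exp_space (k : nat) (X : topologicalType) : Type :=
  set_type (finite_subsets X k).

Section ExpTopology.
Context (k : nat) (X : topologicalType).
Local Notation power := (prod_topology (fun _ : 'I_k => X)).

HB.instance Definition _ := SubChoice.copy (exp_space k X)
  (set_type (finite_subsets X k)).

(* A tuple x : X^k is a function and {x_1} \cup ... \cup {x_k} is its range.
   When 0 < k this is the quotient topology of X^k -> exp_k X (exp_openE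
   below); the image of U is there only to cover k = 0, where exp_0 X is empty
   but X^0 is not. *)
Definition exp_open (U : set (exp_space k X)) : Prop :=
  open [set x : power | (\val @` U) (range x)].

Lemma finite_subsets_range (x : power) :
  (0 < k)%N -> finite_subsets X k (range x).
Proof.
move=> k0; split; first by exists (x (Ordinal k0)), (Ordinal k0).
apply: card_le_trans (card_image_le _ _) _.
by rewrite -(card_le_eql card_II) card_lexx.
Qed.

Definition exp_proj (k0 : (0 < k)%N) (x : power) : exp_space k X :=
  exist _ (range x) (mem_set (finite_subsets_range x k0)).

Lemma exp_openE (k0 : (0 < k)%N) (U : set (exp_space k X)) :
  exp_open U = open (exp_proj k0 @^-1` U).
Proof.
congr open; apply/seteqP; split => x /=; last first.
  by move=> Ux; exists (exp_proj k0 x).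
by move=> [A UA Ax]; rewrite (_ : exp_proj k0 x = A) //; exact: val_inj.
Qed.

Lemma exp_openT : exp_open setT.
Proof.
rewrite /exp_open; have [k0|] := ltnP 0 k.
  rewrite (_ : mkset _ = setT); first exact: openT.
  by apply/seteqP; split => // x _ /=; exists (exp_proj k0 x).
move=> k0; rewrite (_ : mkset _ = set0); first exact: open0.
apply/seteqP; split => // x /= [[A /set_mem[[a Aa] _]] _ /= Ax].
by move: Aa; rewrite Ax => -[i _ _]; have := leq_trans (ltn_ord i) k0.
Qed.

Lemma exp_openI (U V : set (exp_space k X)) :
  exp_open U -> exp_open V -> exp_open (U `&` V).
Proof.
move=> oU oV; rewrite /exp_open.
rewrite (_ : mkset _ = [set x : power | (\val @` U) (range x)] `&`
    [set x : power | (\val @` V) (range x)]); first exact: openI.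
apply/seteqP; split=> x /=.
  by move=> [A [UA VA] Ax]; split; exists A.
move=> [[A UA Ax] [B VB Bx]]; exists A => //; split=> //.
by rewrite (_ : A = B) //; apply: val_inj; rewrite /= Ax -Bx.
Qed.

Lemma exp_open_bigU (I : Type) (U : I -> set (exp_space k X)) :
  (forall i, exp_open (U i)) -> exp_open (\bigcup_i U i).
Proof.
move=> oU; rewrite /exp_open.
rewrite (_ : mkset _ = \bigcup_i [set x : power | (\val @` U i) (range x)]).
  by apply: bigcup_open => i _; exact: oU.
apply/seteqP; split=> x /=.
  by move=> [A [i _ UA] Ax]; exists i => //; exists A.
by move=> [i _ [A UA Ax]]; exists A => //; exists i.
Qed.

HB.instance Definition _ := isOpenTopological.Build (exp_space k X)
  exp_openT exp_openI exp_open_bigU.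

End ExpTopology.

Definition exp_sub (k l : nat) (X : topologicalType) : set (exp_space k X) :=
  [set A | finite_subsets X l (\val A)].
Arguments exp_sub : clear implicits.

Section Homotopy.
Context (R : realType).

Definition unit_interval : topologicalType := set_type [set` `[0%R : R, 1%R]].

(* The endpoints 0 and 1 are quantified over to avoid carrying membership proofs. *)
Definition homotopic (X Y : topologicalType) (f g : X -> Y) : Prop :=
  exists H : X * unit_interval -> Y,
    [/\ continuous H,
        forall x (t : unit_interval), \val t = 0 -> H (x, t) = f x
      & forall x (t : unit_interval), \val t = 1 -> H (x, t) = g x].

Definition homotopy_equivalent (X Y : topologicalType) : Prop :=
  exists (f : X -> Y) (g : Y -> X),
    [/\ continuous f, continuous g,
        homotopic (g \o f) idfun & homotopic (f \o g) idfun].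

Definition sphere (n : nat) : topologicalType :=
  set_type [set x : 'rV[R]_n.+1 | \sum_i x 0 i ^+ 2 = 1].

Definition homeomorphism (X Y : topologicalType) (h : X -> Y) : Prop :=
  exists h' : Y -> X,
    [/\ continuous h, continuous h', cancel h h' & cancel h' h].

Definition ambient_isotopic (X : topologicalType) (K L : set X) : Prop :=
  exists H : X * unit_interval -> X,
    [/\ continuous H,
        forall t, homeomorphism (fun x => H (x, t)),
        forall x (t : unit_interval), \val t = 0 -> H (x, t) = x
      & forall t : unit_interval, \val t = 1 -> (fun x => H (x, t)) @` K = L].

(* The curve (e^{ipt}, e^{iqt}) / sqrt 2 on the Clifford torus in S^3 = the unit
   sphere of C^2, with C^2 identified with R^4 as (Re z, Im z, Re w, Im w). *)
Definition torus_curve (p q : nat) (t : R) : 'rV[R]_4 :=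
  (Num.sqrt 2)^-1 *: \row_j
    [:: cos (p%:R * t); sin (p%:R * t); cos (q%:R * t); sin (q%:R * t)]`_j.

Definition standard_torus_knot (p q : nat) : set (sphere 3) :=
  [set x | exists t, \val x = torus_curve p q t].

(* Knots are unoriented; the roles of p and q can be exchanged, since swapping
   the two factors of C^2 is a rotation of S^3. *)
Definition is_torus_knot (p q : nat) (K : set (sphere 3)) : Prop :=
  ambient_isotopic (standard_torus_knot p q) K.

End Homotopy.

(* Main.v *)
Require Import Defs.
From mathcomp Require Import all_boot all_order all_algebra.
From mathcomp Require Import all_classical all_reals all_analysis.
From mathcomp Require Import ring lra zify.

(** Write k = n + 2.  Both spaces deform onto the double mapping cylinder of the
circle maps of degrees n + 1 and n + 2.  Its points are pairs (t, l) of an angle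
t and a parameter l in [0, 1], where t counts modulo 2 pi for 0 < l < 1, modulo
2 pi / (n + 1) for l = 0 and modulo 2 pi / (n + 2) for l = 1 (core_eq).

On the side of configurations, (t, l) is the set of n + 2 points of the circle
with n + 1 equal gaps d and one gap l d centred at t: a regular (n + 2)-gon for
l = 1, a regular (n + 1)-gon for l = 0.  An arbitrary configuration with n + 1
or n + 2 points has one gap which is the smallest (a zero gap when there are only
n + 1 points); l is the ratio of that gap to the second smallest one and t is an
average of the angles.  When the smallest gap is not unique l is 1, so that the
choice of the gap only matters modulo 2 pi / (n + 2).  Listing the angles in
increasing order from the end of the smallest gap, a configuration is joined to
its core configuration by a straight segment (core_segment): a convex combination
of two lists with positive gaps has positive gaps.

On the side of the knot, a point of the 3-sphere in C^2 is
(cos (pi m / 2) e^(i a), sin (pi m / 2) e^(i b)), and the flow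
(a, b) -> (a + (n + 1) t, b + (n + 2) t) has the knot as an orbit.  Modulo this
flow the sphere has the coordinates m in [0, 1] and the phase
(n + 2) a - (n + 1) b = pi + pi s with s in [-1, 1], and the knot is the point
m = 1/2, s = 1 (or s = -1, which is the same phase).  The square [-1, 1] x [0, 1]
without these two boundary points retracts onto the segment s = 0, with values at
the bottom or top end on the edges s = 1 and s = -1 (weight); moving the angles
along accordingly (slide, deform) makes this a deformation of the knot complement
onto the orbits of the segment, which form the same mapping cylinder.

Every map and homotopy is defined on lifts, where it is given by a formula, and
then descends because a compact set of lifts surjects onto the space and the
target is Hausdorff (presented_map, presented_homotopy).  That the formulas do
not depend on the lift is the content of lift_ambiguity and
torus_point_ambiguity.  Finally an ambient isotopy carries the complement of the
standard torus knot homeomorphically onto that of K. *)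

Set Implicit Arguments.
Unset Strict Implicit.
Unset Printing Implicit Defensive.

Import Order.TTheory GRing.Theory Num.Theory.
Import numFieldNormedType.Exports.
Local Open Scope classical_set_scope.
Local Open Scope ring_scope.

(** * Maps that descend along a compact family of lifts *)

Definition set_mk (T : Type) (A : set T) (x : T) (Ax : A x) : set_type A :=
  exist _ x (mem_set Ax).

Section Descend.
Context (T S Z : topologicalType) (q : T -> S) (D : set T) (h : T -> Z) (p0 : T).

Definition descend (s : S) : Z := h (xget p0 [set p | D p /\ q p = s]).

Hypothesis h_compat : forall p p', D p -> D p' -> q p = q p' -> h p = h p'.

Lemma descendE p : D p -> descend (q p) = h p.
Proof.
move=> Dp; rewrite /descend; case: xgetP => [p' _ [Dp' qp']|/(_ p) /= []].
  exact: h_compat.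
by split.
Qed.

(** A continuous map from a compact space to a Hausdorff space is closed.  The
points of V sent outside an open set O are the images of the lifts in K that lie
outside an open set inducing the preimage of O, so they form a relatively closed
subset of V. *)
Lemma descend_continuous (K : set T) (V : set S) :
  hausdorff_space S -> compact K -> continuous q ->
  (forall p, K p -> V (q p) -> D p) ->
  (forall s, V s -> exists2 p, K p & q p = s) ->
  {within D, continuous h} -> {within V, continuous descend}.
Proof.
move=> hS cK cq KVD surj /continuousP ch; apply/continuousP => O oO.
have /open_subspaceP [U oU UD] := ch _ oO.
have UO x : D x -> U x <-> O (h x).
  move=> Dx; have E : (U `&` D) x = (h @^-1` O `&` D) x by rewrite UD.
  by split=> Hx; [have : (h @^-1` O `&` D) x by rewrite -E|
    have : (U `&` D) x by rewrite E]; case.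
apply/open_subspaceP.
exists (~` (q @` (K `&` ~` U))).
  apply: closed_openC; apply: compact_closed => //.
  apply: continuous_compact; first exact: continuous_subspaceT.
  by apply: compact_closedI => //; exact: open_closedC.
apply/seteqP; split=> s [].
  move=> nqs Vs; split=> //=; have [p Kp qp] := surj _ Vs.
  have Dp : D p by apply: KVD => //; rewrite qp.
  change (O (descend s)); rewrite -qp descendE //.
  by apply/UO => //; apply: contrapT => nU; apply: nqs; exists p.
move=> Os Vs; split=> // -[p [Kp nUp] qp]; apply: nUp.
have Dp : D p by apply: KVD => //; rewrite qp.
by apply/UO => //; rewrite -descendE // qp.
Qed.

End Descend.

Lemma within_comp_continuous (A B Z : topologicalType) (V : set B) (f : A -> B)
    (h : B -> Z) :
  continuous f -> (forall a, V (f a)) -> {within V, continuous h} ->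
  continuous (h \o f).
Proof.
move=> cf Vf /continuousP ch; apply/continuousP => O oO.
have /open_subspaceP [U oU UV] := ch _ oO.
rewrite (_ : _ @^-1` _ = f @^-1` U).
  by apply: open_comp => // x _; exact: cf.
apply/seteqP; split => a /=.
  by move=> Oa; have : (h @^-1` O `&` V) (f a) by []; rewrite -UV => -[].
move=> Ua; have : (U `&` V) (f a) by split.
by rewrite UV => -[].
Qed.

Lemma val_continuous (X : topologicalType) (A : set X) :
  continuous (\val : set_type A -> X).
Proof. exact: (@initial_continuous A X set_val). Qed.

Lemma set_type_continuous (A X : topologicalType) (V : set X)
    (f : A -> set_type V) (a : A) :
  {for a, continuous (fun a => \val (f a))} -> {for a, continuous f}.
Proof.
move=> cf U [_ [/= [W oW <-] Wfa] WU].
have nW : nbhs (\val (f a)) W by exact: open_nbhs_nbhs.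
have fW : nbhs a [set b | W (\val (f b))] := cf W nW.
change (nbhs a [set b | U (f b)]).
by apply: filterS fW => b Wb; apply: WU.
Qed.

Lemma hausdorff_separating (X : topologicalType) (Z : topologicalType) :
  hausdorff_space Z ->
  (forall x y : X, x <> y -> exists2 f : X -> Z, continuous f & f x <> f y) ->
  hausdorff_space X.
Proof.
move=> hZ sep x y cxy; apply: contrapT => /sep [f cf]; apply; apply: hZ.
move=> A B /cf fA /cf fB; have [z [Az Bz]] := cxy _ _ fA fB.
by exists (f z).
Qed.

Lemma hausdorff_set_type (X : topologicalType) (A : set X) :
  hausdorff_space X -> hausdorff_space (set_type A).
Proof.
move=> hX; apply: (hausdorff_separating hX) => x y xy; exists \val.
  exact: val_continuous.
by move=> /val_inj.
Qed.

Lemma hausdorff_prod (X Y : topologicalType) :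
  hausdorff_space X -> hausdorff_space Y -> hausdorff_space (X * Y)%type.
Proof.
move=> hX hY [x y] [x' y'] cxy; congr pair.
  by apply: hX => A B nA nB; have [] := cxy (fst @^-1` A) (fst @^-1` B);
    [exact: cvg_fst|exact: cvg_fst|move=> [a b] [/= ? ?]; exists a].
by apply: hY => A B nA nB; have [] := cxy (snd @^-1` A) (snd @^-1` B);
    [exact: cvg_snd|exact: cvg_snd|move=> [a b] [/= ? ?]; exists b].
Qed.

Lemma row_continuous (R : realType) (A : topologicalType) (n : nat)
    (f : A -> 'rV[R]_n) (a : A) :
  (forall j, {for a, continuous (fun a => f a 0 j)}) -> {for a, continuous f}.
Proof.
move=> cf U [P nP PU].
suff : \forall b \near a, forall i j, P i j (f b i j).
  by apply: filterS => b Pb; apply: PU.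
apply: filter_forall => i; apply: filter_forall => j.
have := cf j (P i j); rewrite ord1; apply.
by have := nP i j; rewrite ord1.
Qed.

Lemma tuple_continuous (A : topologicalType) (X : topologicalType) (I : eqType)
    (f : A -> prod_topology (fun _ : I => X)) (a : A) :
  (forall i, {for a, continuous (fun a => f a i)}) -> {for a, continuous f}.
Proof.
move=> cf; apply/cvg_sup => i; apply/cvg_image.
  by rewrite eqEsubset; split => // x _; exists (fun=> x).
move=> U nU; exists ((fun g : prod_topology (fun _ : I => X) => g i) @^-1` U).
  exact: (cf i).
rewrite eqEsubset; split; first exact: image_preimage_subset.
by move=> x Ux; exists (fun=> x).
Qed.

(** * Continuity at a point *)

Section ContinuityAt.
Context (R : realType) (T : topologicalType) (x : T).
Implicit Types f g : T -> R.

Lemma at_cst (Y : topologicalType) (y : Y) : {for x, continuous (fun _ : T => y)}.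
Proof. exact: cst_continuous. Qed.

Lemma atD f g : {for x, continuous f} -> {for x, continuous g} ->
  {for x, continuous (fun y => f y + g y)}.
Proof. exact: cvgD. Qed.

Lemma atN f : {for x, continuous f} -> {for x, continuous (fun y => - f y)}.
Proof. exact: cvgN. Qed.

Lemma atM f g : {for x, continuous f} -> {for x, continuous g} ->
  {for x, continuous (fun y => f y * g y)}.
Proof. exact: cvgM. Qed.

Lemma atV f : f x != 0 -> {for x, continuous f} ->
  {for x, continuous (fun y => (f y)^-1)}.
Proof. exact: cvgV. Qed.

Lemma at_max f g : {for x, continuous f} -> {for x, continuous g} ->
  {for x, continuous (fun y => Num.max (f y) (g y))}.
Proof. exact: continuous_max. Qed.

Lemma at_min f g : {for x, continuous f} -> {for x, continuous g} ->
  {for x, continuous (fun y => Num.min (f y) (g y))}.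
Proof. exact: continuous_min. Qed.

Lemma at_norm f : {for x, continuous f} -> {for x, continuous (fun y => `|f y|)}.
Proof. exact: cvg_norm. Qed.

Lemma at_comp (Y Z : topologicalType) (h : Y -> Z) (f : T -> Y) :
  continuous h -> {for x, continuous f} -> {for x, continuous (fun y => h (f y))}.
Proof. by move=> ch cf; apply: (@continuous_comp _ _ _ f h) => //; exact: ch. Qed.

Lemma at_pair (Y Z : topologicalType) (f : T -> Y) (g : T -> Z) :
  {for x, continuous f} -> {for x, continuous g} ->
  {for x, continuous (fun y => (f y, g y))}.
Proof. exact: cvg_pair. Qed.

Lemma at_sum (I : finType) (f : I -> T -> R) :
  (forall i, {for x, continuous (f i)}) ->
  {for x, continuous (fun y => \sum_i f i y)}.
Proof.
move=> cf; apply: (@cvg_big R I _ 0 xpredT _ T (nbhs x)) => [p|i _]; last exact: cf.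
exact: add_continuous.
Qed.

End ContinuityAt.

Lemma at_bigmin (R : realType) (T : topologicalType) (x : T) (y0 : R)
    (I : finType) (f : I -> T -> R) :
  (forall i, {for x, continuous (f i)}) ->
  {for x, continuous (fun y => \big[Num.min/y0]_i f i y)}.
Proof.
move=> cf; apply: (@cvg_big R I _ y0 xpredT _ T (nbhs x)) => [p|i _]; last exact: cf.
by apply: at_min; [exact: cvg_fst|exact: cvg_snd].
Qed.

Ltac at_tac := repeat first
  [ exact: at_cst | assumption | apply: atD | apply: atN | apply: atM
  | apply: at_max | apply: at_min | apply: at_norm | apply: at_pair ].

(** * Presentations by lifts *)

Section Presentation.
Context (R : realType) (T S : topologicalType).

(** V is presented by the lifts in D when a compact set of lifts covers V and its
members above V all belong to D.  The compact set may leave D outside V, where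
formulas degenerate.  The condition is stable under product with a compact
factor, which is what homotopies need. *)
Definition presents (q : T -> S) (D : set T) (V : set S) :=
  [/\ continuous q, forall p, D p -> V (q p) &
    exists K, [/\ compact K, forall p, K p -> V (q p) -> D p &
      forall s, V s -> exists2 p, K p & q p = s]].

Lemma presented_map (Z : topologicalType) (q : T -> S) (D : set T) (V : set S)
    (h : T -> Z) (W : set Z) (p0 : T) :
  hausdorff_space S -> presents q D V ->
  (forall p p', D p -> D p' -> q p = q p' -> h p = h p') ->
  (forall p, D p -> {for p, continuous h}) -> (forall p, D p -> W (h p)) ->
  exists2 F : set_type V -> set_type W, continuous F &
    forall p (s : set_type V), D p -> q p = \val s -> \val (F s) = h p.
Proof.
move=> hS [cq DV [K [cK KD Ksurj]]] hq ch hW.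
have cd : {within V, continuous (descend q D h p0)}.
  apply: (@descend_continuous _ _ _ _ _ _ p0 hq K) => //.
  by apply: continuous_in_subspaceT => p /set_mem; exact: ch.
have dW (s : set_type V) : W (descend q D h p0 (\val s)).
  have Vs := set_mem (valP s); have [p Kp qp] := Ksurj _ Vs.
  have Dp : D p by apply: KD => //; rewrite qp.
  by rewrite -qp descendE //; exact: hW.
exists (fun s => set_mk (dW s)).
  move=> s; apply: set_type_continuous => /=.
  exact: (within_comp_continuous (@val_continuous _ V) (fun a => set_mem (valP a)) cd).
by move=> p s Dp qp /=; rewrite -qp descendE.
Qed.

(** The product of K with [0, 1] is a compact family of lifts for the product with
the interval, so homotopies descend by the same argument as maps. *)
Lemma presented_homotopy (Z : topologicalType) (q : T -> S) (D : set T)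
    (V : set S) (h : T * R -> Z) (W : set Z) (p0 : T) :
  hausdorff_space S -> presents q D V ->
  (forall p p' u, 0 <= u <= 1 -> D p -> D p' -> q p = q p' -> h (p, u) = h (p', u)) ->
  (forall p u, D p -> {for (p, u), continuous h}) ->
  (forall p u, 0 <= u <= 1 -> D p -> W (h (p, u))) ->
  exists2 F : set_type V * unit_interval R -> set_type W, continuous F &
    forall p (s : set_type V) u, D p -> q p = \val s ->
      \val (F (s, u)) = h (p, \val u).
Proof.
move=> hS [cq DV [K [cK KD Ksurj]]] hq ch hW.
pose qR (p : T * R) := (q p.1, p.2).
pose DR := [set p : T * R | D p.1 /\ 0 <= p.2 <= 1].
pose VR := [set p : S * R | V p.1 /\ 0 <= p.2 <= 1].
have hqR p p' : DR p -> DR p' -> qR p = qR p' -> h p = h p'.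
  by case: p p' => [p u] [p' u'] [/= Dp u01] [/= Dp' _] [qp <-]; apply: hq.
have cqR : continuous qR.
  move=> p; apply: at_pair; last exact: cvg_snd.
  by apply: (at_comp cq); exact: cvg_fst.
have cd : {within VR, continuous (descend qR DR h (p0, 0))}.
  apply: (@descend_continuous _ _ _ _ _ _ (p0, 0) hqR (K `*` `[0, 1]%classic)) => //.
  - by apply: hausdorff_prod => //; exact: Rhausdorff.
  - by apply: compact_setX => //; exact: segment_compact.
  - by move=> [p u] [/= Kp u01] [/= Vp u01']; split=> //; exact: KD.
  - move=> [s u] [/= Vs u01]; have [p Kp qp] := Ksurj _ Vs.
    by exists (p, u) => //=; rewrite ?in_itv //= /qR /= qp.
  - by apply: continuous_in_subspaceT => -[p u] /set_mem [/= Dp _]; exact: ch.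
have su01 (s : set_type V * unit_interval R) : 0 <= \val s.2 <= 1.
  by have /set_mem := valP s.2; rewrite /= in_itv.
have dW (s : set_type V * unit_interval R) :
    W (descend qR DR h (p0, 0) (\val s.1, \val s.2)).
  have Vs := set_mem (valP s.1); have [p Kp qp] := Ksurj _ Vs.
  have Dp : D p by apply: KD => //; rewrite qp.
  have -> : (\val s.1, \val s.2) = qR (p, \val s.2) by rewrite /qR /= qp.
  have DRp : DR (p, \val s.2) by split=> //=; exact: su01.
  by rewrite descendE //; exact: hW _ _ (su01 s) Dp.
exists (fun s => set_mk (dW s)).
  move=> s; apply: set_type_continuous => /=.
  pose incl (a : set_type V * unit_interval R) : S * R := (\val a.1, \val a.2).
  have ci : continuous incl.
    move=> a; apply: (@at_pair (set_type V * unit_interval R)%type a S R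
        (fun a => \val a.1) (fun a => \val a.2)).
      by apply: (at_comp (@val_continuous _ _)); exact: cvg_fst.
    by apply: (at_comp (@val_continuous _ _)); exact: cvg_snd.
  have iV a : VR (incl a).
    by split=> /=; [exact: set_mem (valP a.1)|exact: su01].
  exact: (within_comp_continuous ci iV cd).
move=> p s u Dp qp /=; have -> : (\val s, \val u) = qR (p, \val u) by rewrite /qR /= qp.
have DRp : DR (p, \val u) by split=> //=; exact: (su01 (s, u)).
by rewrite descendE.
Qed.

End Presentation.

(** * The topology of finite subset spaces *)

Section ExpTopologyFacts.
Context (k : nat) (X : topologicalType) (k0 : (0 < k)%N).
Local Notation power := (prod_topology (fun _ : 'I_k => X)).

Lemma exp_proj_continuous : continuous (exp_proj k0 : power -> exp_space k X).
Proof.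
by apply/continuousP => U oU; rewrite -exp_openE.
Qed.

(** A set of at most k elements injects into k indices; sending the other indices
to one of its elements enumerates it. *)
Lemma exp_proj_surj (A : exp_space k X) : exists x : power, exp_proj k0 x = A.
Proof.
case: A => /= B BE; have [[a Ba] /pcard_leP[f]] := set_mem BE.
exists (fun i : 'I_k => xget a [set b | B b /\ f b = i :> nat]); apply: val_inj => /=.
apply/seteqP; split=> [_ [i _ <-]|b Bb].
  by case: xgetP => // y _ [].
have fbk : (f b < k)%N by apply: (@funS _ _ _ _ f).
exists (Ordinal fbk) => //=; case: xgetP => [y _ [By fyb]|/(_ b) []//].
by apply: (@inj _ _ _ f) => //; exact/mem_set.
Qed.

Lemma open_forall_ord (T : topologicalType) (U : 'I_k -> set T) :
  (forall i, open (U i)) -> open [set x | forall i, U i x].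
Proof.
move=> oU; rewrite openE => x Ux; apply: filter_forall => i.
by apply: open_nbhs_nbhs; split.
Qed.

Lemma exp_open_meets (U : set X) : open U ->
  open [set A : exp_space k X | (\val A `&` U) !=set0].
Proof.
move=> oU; change (exp_open [set A : exp_space k X | (\val A `&` U) !=set0]).
rewrite (exp_openE k0) (_ : _ @^-1` _ =
    \bigcup_(i in setT) ((fun x : power => x i) @^-1` U)).
  apply: bigcup_open => i _; apply: open_comp => // x _.
  exact: (@proj_continuous _ (fun=> X) i).
apply/seteqP; split=> x /=.
  by move=> [_ [[i _ <-] Ui]]; exists i.
by move=> [i _ Ui]; exists (x i); split=> //; exists i.
Qed.

Lemma exp_open_in (U : set X) : open U ->
  open [set A : exp_space k X | \val A `<=` U].
Proof.
move=> oU; change (exp_open [set A : exp_space k X | \val A `<=` U]).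
rewrite (exp_openE k0) (_ : _ @^-1` _ =
    [set x | forall i, ((fun x : power => x i) @^-1` U) x]).
  apply: (@open_forall_ord power) => i.
  change (open ((fun x : power => x i) @^-1` U)); apply: open_comp => // x _.
  exact: (@proj_continuous _ (fun=> X) i).
apply/seteqP; split=> x /=.
  by move=> xU i; apply: xU; exists i.
by move=> xU _ [i _ <-]; apply: xU.
Qed.

(** If a belongs to A but not to the finite set B, the Hausdorff property gives
disjoint open sets U around a and V around B.  The configurations that meet U
and those contained in V are disjoint open sets containing A and B. *)
Lemma exp_hausdorff : hausdorff_space X -> hausdorff_space (exp_space k X).
Proof.
move=> hX.
have sep (A B : exp_space k X) (a : X) : cluster (nbhs A) B ->
  \val A a -> \val B a.
  move=> cAB Aa; apply: contrapT => nBa; have [b bB] := exp_proj_surj B.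
  have nb i : a <> b i by move=> ab; apply: nBa; rewrite -bB ab; exists i.
  have /choice [UV UVP] i : exists UV : set X * set X,
     [/\ open UV.1, open UV.2, UV.1 a, UV.2 (b i) & UV.1 `&` UV.2 = set0].
    move: hX; rewrite open_hausdorff => /(_ a (b i)) [|[U V] /= [/set_mem aU /set_mem bV]].
      exact/eqP.
    by move=> [oU oV /eqP UV0]; exists (U, V).
  pose U := [set c | forall i, (UV i).1 c].
  pose V := \bigcup_i (UV i).2.
  have oU : open U by apply: open_forall_ord => i; have [] := UVP i.
  have oV : open V by apply: bigcup_open => i _; have [] := UVP i.
  have [] := cAB [set C | (\val C `&` U) !=set0] [set C | \val C `<=` V].
  - apply: open_nbhs_nbhs; split; first exact: exp_open_meets.
    by exists a; split=> // i; have [] := UVP i.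
  - apply: open_nbhs_nbhs; split; first exact: exp_open_in.
    by rewrite -bB => _ [i _ <-]; exists i => //; have [] := UVP i.
  move=> C /= [[c [Cc Uc]] CV]; have [i _ Vc] := CV _ Cc.
  have [_ _ _ _ UV0] := UVP i; have : set0 c; last by [].
  by rewrite -UV0; split=> //; exact: Uc.
move=> A B cAB; apply: val_inj; apply/seteqP; split=> a; first exact: sep.
by apply: sep => U V nU nV; rewrite setIC; exact: cAB.
Qed.

End ExpTopologyFacts.

(** * Angles, the circle and join coordinates on the 3-sphere *)

Section Angles.
Context (R : realType).
Implicit Types a b c r x y : R.

Definition same_angle a b := exists m : int, a = b + m%:~R * (2 * pi).

Lemma same_angle_refl a : same_angle a a.
Proof. by exists 0; rewrite mul0r addr0. Qed.

Lemma same_angle_sym a b : same_angle a b -> same_angle b a.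
Proof. by move=> [m ->]; exists (- m); rewrite rmorphN /=; ring. Qed.

Lemma same_angleD a b c d : same_angle a b -> same_angle c d ->
  same_angle (a + c) (b + d).
Proof. by move=> [m ->] [p ->]; exists (m + p); rewrite rmorphD /=; ring. Qed.

Lemma same_angleMn p a b : same_angle a b -> same_angle (p%:R * a) (p%:R * b).
Proof. by move=> [m ->]; exists (p%:Z * m); rewrite rmorphM /=; ring. Qed.

Lemma same_angleN a b : same_angle a b -> same_angle (- a) (- b).
Proof. by move=> [m ->]; exists (- m); rewrite rmorphN /=; ring. Qed.

Lemma cosD2piz a (m : int) : cos (a + m%:~R * (2 * pi)) = cos a.
Proof.
have E (p : nat) b : cos (b + p%:R * (2 * pi)) = cos b.
  rewrite (_ : p%:R * (2 * pi) = (pi *+ 2) *+ p); first exact: (periodicn (@cosD2pi R)).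
  by rewrite -mulr_natl mulr_natl; ring.
case: m => p /=; first exact: E.
rewrite NegzE -(E p.+1 (a + (- p.+1%:Z)%:~R * _)); congr cos.
by rewrite rmorphN /= -pmulrn; ring.
Qed.

Lemma sinD2piz a (m : int) : sin (a + m%:~R * (2 * pi)) = sin a.
Proof.
by rewrite -!cosBpihalf -(cosD2piz (a - pi / 2) m); congr cos; ring.
Qed.

(** The remainder r of c modulo 2 pi has cosine 1, and 0 < r < 2 pi is impossible
because cos r = 1 - 2 sin (r / 2) ^ 2. *)
Lemma cos_eq1 c : cos c = 1 -> same_angle c 0.
Proof.
move=> c1; have pi0 : 0 < 2 * pi :> R by rewrite mulr_gt0 ?pi_gt0.
set m := Num.floor (c / (2 * pi)); exists m; rewrite add0r.
pose r := c - m%:~R * (2 * pi).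
have r0 : 0 <= r.
  by rewrite subr_ge0 -ler_pdivlMr //; exact: floor_le.
have r2 : r < 2 * pi.
  rewrite /r ltrBlDr -[X in X + _]mul1r -mulrDl -ltr_pdivrMr // addrC.
  by rewrite -[1]/(1%:~R) -rmorphD /=; exact: floorD1_gt.
have cr : cos r = 1.
  by rewrite -c1 /r -(cosD2piz (c - _) m) subrK.
suff : r = 0 by move/eqP; rewrite subr_eq0 => /eqP.
apply/eqP; apply: contraT => rn0.
have rp : 0 < r by rewrite lt_def rn0.
have : 0 < sin (r / 2) by apply: sin_gt0_pi; lra.
have : cos (r / 2 *+ 2) = 1 by rewrite -mulr_natr divfK // pnatr_eq0.
rewrite cos_mulr2n cos2sin2; nra.
Qed.

Lemma same_angleP a b : cos a = cos b -> sin a = sin b -> same_angle a b.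
Proof.
move=> ca sa; have [|m E] := @cos_eq1 (a - b).
  by rewrite cosB ca sa -!expr2 cos2Dsin2.
by exists m; rewrite -[LHS](subrK b) E; ring.
Qed.

Lemma same_angle_cos a b : same_angle a b -> cos a = cos b.
Proof. by move=> [m ->]; rewrite cosD2piz. Qed.

Lemma same_angle_sin a b : same_angle a b -> sin a = sin b.
Proof. by move=> [m ->]; rewrite sinD2piz. Qed.

Lemma same_angle_eq a b :
  same_angle a b -> - (2 * pi) < a - b < 2 * pi -> a = b.
Proof.
have pi0 : 0 < 2 * pi :> R by rewrite mulr_gt0 ?pi_gt0.
move=> [m ->]; rewrite (addrC b) addrK => /andP[lo hi].
have m1 : m < 1 by rewrite -(ltr_int R) -(ltr_pM2r pi0) mul1r.
have m0 : -1 < m by rewrite -(ltr_int R) -(ltr_pM2r pi0) rmorphN /= mulN1r.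
have -> : m = 0 by lia.
by rewrite mul0r add0r.
Qed.

Lemma polar_coordinates x y r : 0 <= r -> x ^+ 2 + y ^+ 2 = r ^+ 2 ->
  exists2 a, 0 <= a <= 2 * pi & x = r * cos a /\ y = r * sin a.
Proof.
have pi0 := @pi_gt0 R.
rewrite le_eqVlt => /orP[/eqP <- E|r0 E].
  by exists 0; [lra|split; nra].
have xr : -1 <= x / r <= 1.
  rewrite -ler_norml normrM normfV (gtr0_norm r0) ler_pdivrMr // mul1r.
  by rewrite -(ler_pXn2r (n := 2)) ?nnegrE ?normr_ge0 ?(ltW r0) // real_normK ?num_real //; nra.
have C := acosK xr; have := acos_ge0 xr; have := acos_lepi xr.
set u := acos _ in C * => u1 u0.
have S : r * sin u = `|y|.
  rewrite sin_acos // -[LHS]ger0_norm; last by rewrite mulr_ge0 ?sqrtr_ge0 // ltW.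
  apply/eqP; rewrite -(eqrXn2 (n := 2)) ?normr_ge0 // !real_normK ?num_real //.
  rewrite exprMn sqr_sqrtr; last first.
    rewrite subr_ge0 -[1](expr1n _ 2) -real_normK ?num_real //.
    by rewrite lerXn2r ?nnegrE ?normr_ge0 ?ler01 // ler_norml.
  apply/eqP; transitivity (r ^+ 2 - x ^+ 2); last by rewrite -E; ring.
  by field; rewrite gt_eqF.
have xE : x = r * cos u by rewrite C mulrCA divff ?gt_eqF // mulr1.
have [y0|y0] := leP 0 y.
  exists u; first lra.
  by rewrite S ger0_norm.
exists (2 * pi - u); first lra.
have -> : cos (2 * pi - u) = cos u.
  by rewrite -(cosN u) -(cosD2piz (- u) 1) mul1r addrC.
have -> : sin (2 * pi - u) = - sin u.
  by rewrite -(sinN u) -(sinD2piz (- u) 1) mul1r addrC.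
by split=> //; rewrite mulrN S ltr0_norm // opprK.
Qed.

Lemma sphere1_subproof a :
  [set x : 'rV[R]_2 | \sum_i x 0 i ^+ 2 = 1] (\row_j [:: cos a; sin a]`_j).
Proof.
by rewrite /= !big_ord_recl big_ord0 !mxE /= addr0 cos2Dsin2.
Qed.

Definition circle a : sphere R 1 := 
  set_mk (sphere1_subproof a).

Lemma circleP a b : circle a = circle b <-> same_angle a b.
Proof.
split=> [/(congr1 \val)/= /rowP E|[m ->]].
  by apply: same_angleP; [have := E 0|have := E 1]; rewrite !mxE.
by apply: val_inj => /=; rewrite cosD2piz sinD2piz.
Qed.

Lemma circle_surj (s : sphere R 1) : exists2 a, 0 <= a < 2 * pi & circle a = s.
Proof.
have pi0 := @pi_gt0 R.
have /set_mem := valP s; rewrite /= !big_ord_recl big_ord0 addr0 => E.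
have [||a a2 [x y]] := @polar_coordinates (\val s 0 ord0) (\val s 0 (lift ord0 ord0)) 1 => //.
  by rewrite expr1n.
have sa : circle a = s.
  apply: val_inj; apply/rowP => j; rewrite /= mxE.
  by case: j => [[|[|//]]] j /=; rewrite -[LHS]mul1r -?x -?y; congr (\val s 0 _); apply: val_inj.
have [a2'|a2'] := ltP a (2 * pi); first by exists a => //; lra.
exists 0; first lra.
by rewrite -sa; apply/circleP; exists (-1); rewrite rmorphN /=; lra.
Qed.

Lemma circle_continuous : continuous circle.
Proof.
move=> a; apply: set_type_continuous; apply: row_continuous => j.
have -> : (fun b => \val (circle b) 0 j) = (fun b => [:: cos b; sin b]`_j).
  by apply/funext => b; rewrite mxE.
by case: j => [[|[|//]]] j /=; [exact: continuous_cos|exact: continuous_sin].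
Qed.

Lemma sphere_hausdorff d : hausdorff_space (sphere R d).
Proof. by apply: hausdorff_set_type; exact: norm_hausdorff. Qed.

Lemma sphere3_subproof f a b :
  [set x : 'rV[R]_4 | \sum_i x 0 i ^+ 2 = 1]
    (\row_j [:: cos f * cos a; cos f * sin a; sin f * cos b; sin f * sin b]`_j).
Proof.
rewrite /= !big_ord_recl big_ord0 !mxE /= addr0 !exprMn !sin2cos2; ring.
Qed.

(** The 3-sphere as the join of two circles: f is the latitude, 0 on the first
circle and pi / 2 on the second. *)
Definition join_point f a b : sphere R 3 :=
  
  set_mk (sphere3_subproof f a b).

Lemma join_point_congr f a b a' b' :
  (cos f = 0 \/ same_angle a a') -> (sin f = 0 \/ same_angle b b') ->
  join_point f a b = join_point f a' b'.
Proof.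
move=> Ha Hb; apply: val_inj => /=; congr (\row_j nth 0 _ j).
by case: Ha Hb => [->|Ha] [->|Hb]; rewrite ?mul0r //
  ?(same_angle_cos Ha) ?(same_angle_sin Ha) ?(same_angle_cos Hb) ?(same_angle_sin Hb).
Qed.

(** The latitude is read off from the modulus cos f of the first complex
coordinate; the argument of a coordinate is determined when it is nonzero. *)
Lemma join_point_inj f a b f' a' b' :
  0 <= f <= pi / 2 -> 0 <= f' <= pi / 2 -> join_point f a b = join_point f' a' b' ->
  [/\ f = f', f < pi / 2 -> same_angle a a' & 0 < f -> same_angle b b'].
Proof.
move=> Hf Hf' /(congr1 \val)/= /rowP E; have pi0 := @pi_gt0 R.
have E0 : cos f * cos a = cos f' * cos a' by have := E (@Ordinal 4 0 isT); rewrite !mxE.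
have E1 : cos f * sin a = cos f' * sin a' by have := E (@Ordinal 4 1 isT); rewrite !mxE.
have E2 : sin f * cos b = sin f' * cos b' by have := E (@Ordinal 4 2 isT); rewrite !mxE.
have E3 : sin f * sin b = sin f' * sin b' by have := E (@Ordinal 4 3 isT); rewrite !mxE.
have c0 : 0 <= cos f by apply: cos_ge0_pihalf; lra.
have c0' : 0 <= cos f' by apply: cos_ge0_pihalf; lra.
have ff : f = f'.
  apply: cos_inj; rewrite ?in_itv /=; [lra|lra|].
  apply/eqP; rewrite -(eqrXn2 (n := 2)) //; apply/eqP.
  transitivity ((cos f * cos a) ^+ 2 + (cos f * sin a) ^+ 2).
    by rewrite !exprMn -mulrDr cos2Dsin2 mulr1.
  by rewrite E0 E1 !exprMn -mulrDr cos2Dsin2 mulr1.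
split=> // Hlt; subst f'.
  have cf : cos f != 0 by rewrite gt_eqF // cos_gt0_pihalf //; lra.
  by apply: same_angleP; [move: E0|move: E1] => /(mulfI cf).
have sf : sin f != 0 by rewrite gt_eqF // sin_gt0_pi //; lra.
by apply: same_angleP; [move: E2|move: E3] => /(mulfI sf).
Qed.

Lemma join_point_surj (s : sphere R 3) :
  exists f a b, 0 <= f <= pi / 2 /\ join_point f a b = s.
Proof.
have /set_mem := valP s; rewrite /= !big_ord_recl big_ord0 addr0.
set x0 := \val s 0 _; set x1 := \val s 0 _; set x2 := \val s 0 _; set x3 := \val s 0 _ => E.
pose r := Num.sqrt (x0 ^+ 2 + x1 ^+ 2); pose r' := Num.sqrt (x2 ^+ 2 + x3 ^+ 2).
have r0 : 0 <= r by exact: sqrtr_ge0.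
have r0' : 0 <= r' by exact: sqrtr_ge0.
have rE : r ^+ 2 = x0 ^+ 2 + x1 ^+ 2 by rewrite sqr_sqrtr // addr_ge0 ?sqr_ge0.
have rE' : r' ^+ 2 = x2 ^+ 2 + x3 ^+ 2 by rewrite sqr_sqrtr // addr_ge0 ?sqr_ge0.
have [a _ [xa ya]] := polar_coordinates r0 (esym rE).
have [b _ [xb yb]] := polar_coordinates r0' (esym rE').
have rr : r ^+ 2 + r' ^+ 2 = 1 by rewrite rE rE' -E; ring.
have r1 : -1 <= r <= 1 by nra.
exists (acos r), a, b; split.
  rewrite acos_ge0 //=; rewrite leNgt; apply/negP => lt.
  have : cos (acos r) < 0.
    have := acos_lepi r1 => le.
    rewrite -(subrK pi (acos r)) cosDpi oppr_lt0 cos_gt0_pihalf //.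
    have := @pi_gt0 R; lra.
  by rewrite acosK //; lra.
apply: val_inj; apply/rowP => j; rewrite /= mxE acosK //.
have -> : sin (acos r) = r'.
  rewrite sin_acos //; apply/eqP; rewrite -(eqrXn2 (n := 2)) ?sqrtr_ge0 //.
  rewrite sqr_sqrtr; first by apply/eqP; lra.
  have := sqr_ge0 r'; lra.
by case: j => [[|[|[|[|//]]]]] j /=; rewrite -?xa -?ya -?xb -?yb;
  congr (\val s 0 _); apply: val_inj.
Qed.

End Angles.
Arguments circle {R} a.

(** * Increasing sequences indexed by the integers *)

Lemma int_arith_progression (V : zmodType) (f : int -> V) (c : V) :
  (forall i, f (i + 1) = f i + c) -> forall i, f i = f 0 + c *~ i.
Proof.
move=> fS; elim/int_rect => [|p IH|p IH]; first by rewrite mulr0z addr0.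
  by rewrite intS addrC fS IH mulrzDr mulr1z addrA addrAC.
have -> : - p.+1%:Z = - p%:Z - 1 by lia.
by apply: (addIr c); rewrite -fS subrK IH mulrzBr mulr1z addrA subrK.
Qed.

Lemma int_increasing (R : realType) (u : int -> R) :
  (forall i, u i < u (i + 1)) -> {mono u : i j / i < j}.
Proof.
move=> uS.
have uD i (p : nat) : u i < u (i + p.+1%:Z).
  elim: p => [|p IH]; first exact: uS.
  by apply: lt_trans IH _; have -> : i + p.+2%:Z = i + p.+1%:Z + 1 by lia.
have lt i j : i < j -> u i < u j.
  move=> ij; have -> : j = i + (`|(j - i)%R|%N.-1.+1)%:Z by lia.
  exact: uD.
move=> i j; have [/lt//|ji|->] := ltgtP i j; last by rewrite ltxx.
by apply/negbTE; rewrite -leNgt ltW ?lt.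
Qed.

Lemma int_mono_inj (R : realType) (u : int -> R) :
  {mono u : i j / i < j} -> injective u.
Proof.
by move=> mu i j uij; have [ij|ij|//] := ltgtP i j; move: ij; rewrite -mu uij ltxx.
Qed.

(** The reindexing s with v = u o s is an increasing bijection of the integers,
and no integer fits strictly between s i and s (i + 1); hence s is a translation. *)
Lemma increasing_same_range (R : realType) (u v : int -> R) :
  {mono u : i j / i < j} -> {mono v : i j / i < j} ->
  (forall i, exists j, v i = u j) -> (forall i, exists j, u i = v j) ->
  exists m, forall i, v i = u (i + m).
Proof.
move=> mu mv vu uv; have [s sE] := choice vu.
have ms i j : (s i < s j) = (i < j) by rewrite -mu -!sE mv.
have uI := int_mono_inj mu.
have ss i : exists j, s j = i.
  by have [j] := uv i; rewrite sE => /uI ->; exists j.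
have sS i : s (i + 1) = s i + 1.
  have lt : s i < s (i + 1) by rewrite ms; lia.
  have [//|ne] := eqVneq (s (i + 1)) (s i + 1).
  have [j sj] := ss (s i + 1).
  have : s i < s j by rewrite sj; lia.
  have : s j < s (i + 1) by rewrite sj; lia.
  by rewrite !ms => ? ?; lia.
exists (s 0) => i; rewrite sE; congr u.
by rewrite (int_arith_progression sS) intz addrC.
Qed.

Section Periodic.
Context (R : realType).
Implicit Types (p : nat) (x : nat -> R) (z : int -> R).

Lemma periodic_mul p z : (forall i, z (i + p%:Z) = z i + 2 * pi) ->
  forall i m, z (i + m * p%:Z) = z i + m%:~R * (2 * pi).
Proof.
move=> zp i m; have := @int_arith_progression R (fun m => z (i + m * p%:Z)) (2 * pi).
move=> /(_ _ m) ->; first by rewrite mul0r addr0 mulrzl.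
by move=> j; rewrite mulrDl mul1r addrA zp.
Qed.

(** Shifting the window by one index replaces z i by z (i + p), adding 2 pi. *)
Lemma periodic_sum p z (m : int) : (forall i, z (i + p%:Z) = z i + 2 * pi) ->
  \sum_(j < p) z (j%:Z + m) = \sum_(j < p) z j%:Z + m%:~R * (2 * pi).
Proof.
move=> zp; pose f (m : int) := \sum_(j < p) z (j%:Z + m).
have := @int_arith_progression R f (2 * pi).
rewrite /f => /(_ _ m) ->.
  by rewrite mulrzl; under eq_bigr do rewrite addr0.
move=> i; have T : \sum_(j < p) (z (j.+1%:Z + i) - z (j%:Z + i)) = 2 * pi.
  have := @telescope_sumr R 0 p (fun j => z (j%:Z + i)) (leq0n _).
  by rewrite big_mkord => ->; rewrite add0r [p%:Z + i]addrC zp; ring.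
rewrite -[in RHS]T -big_split /=; apply: eq_bigr => j _.
by rewrite addrC subrK; congr z; lia.
Qed.

Lemma periodic_image p N z : (0 < p)%N -> (p <= N)%N ->
  (forall i, z (i + p%:Z) = z i + 2 * pi) ->
  range (fun i : 'I_N => circle (z i%:Z)) = range (circle \o z).
Proof.
move=> p0 pN zp; apply/seteqP; split=> _ [i _ <-]; first by exists i%:Z.
have r0 : (`|(i %% p)%Z| < N)%N.
  apply: leq_trans pN; rewrite -ltz_nat gez0_abs ?modz_ge0 ?ltz_pmod //; lia.
exists (Ordinal r0) => //=; apply/circleP; apply: same_angle_sym.
exists (i %/ p)%Z; rewrite -(periodic_mul zp); congr z.
by rewrite gez0_abs ?modz_ge0 //; first rewrite addrC -divz_eq //; lia.
Qed.

(** All lifts to the real line of the p points of angles x 0, ..., x (p - 1). *)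
Definition periodic_ext p x (i : int) : R :=
  x `|(i %% p)%Z|%N + (i %/ p)%Z%:~R * (2 * pi).

Lemma periodic_extD p x i : (0 < p)%N ->
  periodic_ext p x (i + p%:Z) = periodic_ext p x i + 2 * pi.
Proof.
move=> p0; rewrite /periodic_ext modzDr divzDr ?divzz ?dvdzz //.
have -> : (p%:Z != 0) = true by lia.
by rewrite rmorphD /= mulrDl mul1r addrA.
Qed.

Lemma periodic_ext_nat p x (i : nat) : (i < p)%N -> periodic_ext p x i%:Z = x i.
Proof.
by move=> ip; rewrite /periodic_ext modz_nat divz_nat modn_small // divn_small // mul0r addr0.
Qed.

Definition cyclic_gap p x (r : nat) : R :=
  if (r.+1 < p)%N then x r.+1 - x r else x 0%N + 2 * pi - x r.

Lemma periodic_ext_gap_nat p x (r : nat) : (r < p)%N ->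
  periodic_ext p x (r%:Z + 1) - periodic_ext p x r%:Z = cyclic_gap p x r.
Proof.
move=> rp; rewrite [X in _ - X]periodic_ext_nat // /cyclic_gap; case: ltnP => [lt|ge].
  have -> : r%:Z + 1 = r.+1%:Z by lia.
  by rewrite periodic_ext_nat.
have -> : (r%:Z + 1 = 0 + p%:Z)%R by lia.
by rewrite periodic_extD ?periodic_ext_nat //; lia.
Qed.

Lemma periodic_ext_gap p x i : (0 < p)%N ->
  exists2 r, (r < p)%N & periodic_ext p x (i + 1) - periodic_ext p x i = cyclic_gap p x r.
Proof.
move=> p0; set q := (i %/ p)%Z; pose r := `|(i %% p)%Z|%N.
have rp : (r < p)%N by rewrite /r -ltz_nat gez0_abs ?modz_ge0 ?ltz_pmod //; lia.
have iE : i = r%:Z + q * p%:Z.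
  by rewrite /r gez0_abs ?modz_ge0 //; first rewrite addrC -divz_eq //; lia.
exists r => //; rewrite -periodic_ext_gap_nat //.
have xp := @periodic_mul p (periodic_ext p x) (fun i => periodic_extD x i p0).
rewrite iE (_ : r%:Z + q * p%:Z + 1 = (r%:Z + 1) + q * p%:Z); last by rewrite addrAC.
by rewrite !xp; ring.
Qed.

Definition increasing_lift p x :=
  (0 < p)%N /\ forall r, (r < p)%N -> 0 < cyclic_gap p x r.

Lemma periodic_ext_increasing p x : increasing_lift p x ->
  {mono periodic_ext p x : i j / i < j}.
Proof.
move=> [p0 xS]; apply: int_increasing => i; rewrite -subr_gt0.
by have [r rp ->] := periodic_ext_gap x i p0; exact: xS.
Qed.

(** Both extensions enumerate increasingly the set of all angles of the common
image, so they differ by a shift; adding 2 pi then amounts to adding p, and also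
p', to the index. *)
Lemma same_image_shift p p' x x' : increasing_lift p x -> increasing_lift p' x' ->
  range (fun i : 'I_p => circle (x i)) = range (fun i : 'I_p' => circle (x' i)) ->
  p = p' /\ exists m, forall i, periodic_ext p x' i = periodic_ext p x (i + m).
Proof.
move=> ix ix' E; have [p0 _] := ix; have [p0' _] := ix'.
have per := fun i => periodic_extD x i p0; have per' := fun i => periodic_extD x' i p0'.
have Er : range (circle \o periodic_ext p x) = range (circle \o periodic_ext p' x').
  rewrite -(periodic_image p0 (leqnn _) per) -(periodic_image p0' (leqnn _) per').
  transitivity (range (fun i : 'I_p => circle (x i))).
    by congr image; apply/funext => i; rewrite periodic_ext_nat.
  by rewrite E; congr image; apply/funext => i; rewrite periodic_ext_nat.
have sub q q' y y' : (0 < q')%N ->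
    range (circle \o periodic_ext q y) = range (circle \o periodic_ext q' y') ->
    forall i, exists j, periodic_ext q y i = periodic_ext q' y' j.
  move=> q0 Eq i.
  have : range (circle \o periodic_ext q y) (circle (periodic_ext q y i)) by exists i.
  rewrite Eq => -[j _ /= /circleP/same_angle_sym [m ->]].
  by exists (j + m * q'%:Z); rewrite (periodic_mul (fun i => periodic_extD y' i q0)).
have [m mE] := increasing_same_range
  (periodic_ext_increasing ix) (periodic_ext_increasing ix')
  (sub _ _ _ _ p0 (esym Er)) (sub _ _ _ _ p0' Er).
suff pp : p = p' by split=> //; subst p'; exists m.
have := per' 0; rewrite !mE add0r -per => /(int_mono_inj (periodic_ext_increasing ix)).
by lia.
Qed.

End Periodic.

(** * Ordered lifts of configurations on the circle *)

Lemma sum_ord_natr (R : realFieldType) (p : nat) :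
  \sum_(i < p) i%:R = p%:R * (p%:R - 1) / 2 :> R.
Proof.
elim: p => [|p IH]; first by rewrite big_ord0 mul0r mul0r.
by rewrite big_ord_recr /= IH -natr1; field.
Qed.

Section Lifts.
Context (R : realType) (n : nat).
Local Notation lift := (prod_topology (fun _ : 'I_n.+2 => R)).
Local Notation config := (exp_space n.+2 (sphere R 1)).
Implicit Types (x : lift) (t l u : R).

Definition pt x (i : nat) : R := x (inord i).
Definition gap x (i : nat) : R := pt x i.+1 - pt x i.
Definition last_gap x : R := pt x 0 + 2 * pi - pt x n.+1.

(** Lists of n + 2 angles in increasing order, within one turn, whose closing gap
is the smallest.  Only the closing gap may vanish: the configuration then has
n + 1 points, the first of which is listed again at the end. *)
Definition balanced : set lift := [set x |
  forall i : 'I_n.+1, 0 < gap x i /\ 0 <= last_gap x <= gap x i].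

(** Letting gaps vanish makes this set compact.  The bound 4 pi leaves room for
the rotation performed in lift_surj. *)
Definition lift_box : set lift := [set x | 0 <= pt x 0 <= 4 * pi /\
  forall i : 'I_n.+1, 0 <= last_gap x <= gap x i].

Definition points x : config := exp_proj (ltn0Sn n.+1) (circle \o x).

Lemma pointsP x x' : range (fun i : 'I_n.+2 => circle (pt x i)) =
  range (fun i : 'I_n.+2 => circle (pt x' i)) <-> points x = points x'.
Proof.
have E y : range (fun i : 'I_n.+2 => circle (pt y i)) = \val (points y).
  by congr image; apply/funext => i; rewrite /pt inord_val.
by rewrite !E; split=> [/val_inj|->].
Qed.

Lemma pt_cyclic_gap x r : (r < n.+2)%N ->
  cyclic_gap n.+2 (pt x) r = if (r < n.+1)%N then gap x r else last_gap x.
Proof.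
move=> rn; rewrite /cyclic_gap ltnS; case: ltnP => // ge.
by have -> : r = n.+1 by lia.
Qed.

Lemma pt_monotone x : (forall i : 'I_n.+1, 0 <= gap x i) ->
  forall i j, (i <= j <= n.+1)%N -> pt x i <= pt x j.
Proof.
move=> H i; elim=> [|j IH]; first by rewrite leqn0 => /andP[/eqP ->].
move=> /andP[]; rewrite leq_eqVlt => /orP[/eqP -> //|ij jn].
apply: le_trans (IH _) _; first by lia.
by rewrite -subr_ge0; exact: (H (Ordinal jn)).
Qed.

(** The first n + 1 angles are distinct modulo 2 pi, since they increase and span
less than one turn. *)
Lemma balanced_many_points x : (forall i : 'I_n.+1, 0 < gap x i) ->
  0 <= last_gap x -> ~ exp_sub n.+2 n (sphere R 1) (points x).
Proof.
move=> gx lx [_]; pose f i := circle (pt x i).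
have mono := pt_monotone (fun i => ltW (gx i)).
have lt i j : (i < j <= n)%N -> pt x i < pt x j.
  move=> /andP[ij jn]; apply: lt_le_trans (mono i.+1 j _); last lia.
  have i1 : (i < n.+1)%N by lia.
  by rewrite -subr_gt0; exact: (gx (Ordinal i1)).
have nwrap i j : (i <= n)%N -> (j <= n)%N -> pt x j - pt x i < 2 * pi.
  move=> ni jn; have := mono 0%N i; have := mono j n.
  have := gx ord_max; rewrite /gap /=; move: lx; rewrite /last_gap.
  by move=> ? ? /(_ ltac:(lia)) ? /(_ ltac:(lia)) ?; lra.
have fI : {in `I_n.+1 &, injective f}.
  move=> i j; rewrite !inE /= !ltnS => ni nj /circleP /same_angle_eq.
  have := nwrap i j ni nj; have := nwrap j i nj ni => ? ? /(_ ltac:(lra)) E.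
  have [ij|ij|//] := ltngtP i j.
    by have := lt i j; rewrite E ltxx ij nj => /(_ isT).
  by have := lt j i; rewrite E ltxx ij ni => /(_ isT).
move=> cA; suff : (`I_n.+1 #<= `I_n)%card by rewrite card_le_II ltnn.
apply: card_le_trans cA; rewrite -(card_le_eql (inj_card_eq fI)).
apply: subset_card_le => _ [i /= ni <-].
by exists (inord i).
Qed.

(** If a gap other than the closing one vanishes, then so does the closing gap,
which is the smallest.  Two of the n + 2 listed points are then redundant. *)
Lemma degenerate_few_points x : lift_box x ->
  ~ balanced x -> exp_sub n.+2 n (sphere R 1) (points x).
Proof.
move=> [_ bx] nb.
have [i gi] : exists i : 'I_n.+1, gap x i <= 0.
  apply: contrapT => H; apply: nb => i; split; last exact: bx.
  by rewrite ltNge; apply/negP => ?; apply: H; exists i.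
have [gi0 l0] : gap x i = 0 /\ last_gap x = 0.
  by have := bx i => /andP[? ?]; split; lra.
have pi0 := @pi_gt0 R.
have n0 : (0 < n)%N.
  rewrite lt0n; apply/eqP => n0; move: gi0 l0; rewrite /gap /last_gap.
  have -> : i = 0%N :> nat by have := ltn_ord i; lia.
  by rewrite n0; lra.
(* r is the other redundant index; it is never 0, which the last index needs *)
pose f j := circle (pt x j); pose r := if (i < n)%N then i.+1 else n.
have r0 : (0 < r)%N by rewrite /r; case: ifP.
have wrap : f n.+1 = f 0%N.
  by apply/circleP; exists 1; rewrite mul1r; move: l0; rewrite /last_gap; lra.
have fr : exists2 m, (m < n)%N & f (bump r m) = f r.
  rewrite /r; case: ltnP => lt.
    exists i => //; rewrite /bump ltnn; congr circle.
    by move: gi0; rewrite /gap add0n; lra.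
  exists 0%N => //; rewrite /bump leqNgt n0 -wrap; congr circle.
  have <- : nat_of_ord i = n by have := ltn_ord i; lia.
  by move: gi0; rewrite /gap; lra.
have sub : \val (points x) `<=` [set f (bump r m) | m in `I_n].
  move=> _ [j _ <-] /=.
  have -> : circle (x j) = f j by rewrite /f /pt inord_val.
  have [jr|jr] := eqVneq (j : nat) r.
    by have [m mn E] := fr; exists m => //; rewrite E jr.
  have [jn|jn] := eqVneq (j : nat) n.+1.
    by exists 0%N => //=; rewrite jn wrap /bump leqNgt r0.
  exists (unbump r j); last by rewrite unbumpK // inE eq_sym.
  have : (r <= n)%N by rewrite /r; case: ifP.
  by rewrite /= /unbump; have := ltn_ord j; case: ltnP; lia.
split; first by exists (circle (x ord0)), ord0.
apply: card_le_trans (subset_card_le sub) _.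
exact: card_image_le.
Qed.

(** List the angles in [0, 2 pi) in increasing order, extend periodically, and
start the list right after a smallest gap. *)
Lemma lift_surj (A : config) : exists2 x, lift_box x & points x = A.
Proof.
have [s sA] := exp_proj_surj (ltn0Sn n.+1) A.
have /choice [a aP] i : exists b, 0 <= b < 2 * pi /\ circle b = s i.
  by have [b] := circle_surj (s i); exists b.
pose l := sort <=%R [seq a i | i <- enum 'I_n.+2]; pose y j := nth 0 l j.
have sl : size l = n.+2 by rewrite size_sort size_map size_enum_ord.
have y_of j : (j < n.+2)%N -> exists i, y j = a i.
  move=> jn; have : y j \in l by rewrite mem_nth ?sl.
  by rewrite mem_sort => /mapP[i _ ->]; exists i.
have of_y i : exists2 j : 'I_n.+2, True & y j = a i.
  have ai : a i \in l by rewrite mem_sort map_f // mem_enum.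
  have jn : (index (a i) l < n.+2)%N by rewrite -sl index_mem.
  by exists (Ordinal jn) => //; rewrite /y nth_index.
have y02 j : (j < n.+2)%N -> 0 <= y j < 2 * pi.
  by move=> /y_of [i ->]; have [] := aP i.
have ymono j : (j.+1 < n.+2)%N -> y j <= y j.+1.
  move=> jn; have /(sortedP 0) := sort_sorted (@le_total _ R) [seq a i | i <- enum 'I_n.+2].
  by apply; rewrite -/l sl.
have y_gap r : (r < n.+2)%N -> 0 <= cyclic_gap n.+2 y r.
  rewrite /cyclic_gap => rn; case: ltnP => lt; first by rewrite subr_ge0 ymono.
  by have := y02 _ rn; have := y02 0%N isT; lra.
pose e := periodic_ext n.+2 y.
have eP i : e (i + n.+2%:Z) = e i + 2 * pi by exact: periodic_extD.
(* i0 is the index of a smallest gap, so the list below starts at i0 + 1 *)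
have := @arg_minP _ R 'I_n.+2 ord0 predT (fun i => e (i%:Z + 1) - e i%:Z) isT.
case=> i0 _ min0.
have emin m : 0 <= e (i0%:Z + 1) - e i0%:Z <= e (m + 1) - e m.
  apply/andP; split; first by rewrite [leRHS]periodic_ext_gap_nat ?y_gap.
  have [r rn E] := periodic_ext_gap y m (ltn0Sn n.+1).
  by rewrite [leRHS]E -periodic_ext_gap_nat //; exact: (min0 (Ordinal rn)).
pose x : lift := fun i : 'I_n.+2 => e (i0%:Z + 1 + i%:Z).
have ptx j : (j < n.+2)%N -> pt x j = e (i0%:Z + 1 + j%:Z).
  by move=> jn; rewrite /pt /x inordK.
have lx : last_gap x = e (i0%:Z + 1) - e i0%:Z.
  rewrite /last_gap !ptx // addr0 -eP; have -> : i0%:Z + 1 + n.+1%:Z = i0%:Z + n.+2%:Z by lia.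
  by rewrite !eP; ring.
exists x.
  rewrite /lift_box /=; split=> [|i].
    rewrite ptx // addr0; have := ltn_ord i0; rewrite ltnS leq_eqVlt => /orP[/eqP ->|lt].
      have -> : n.+1%:Z + 1 = 0 + n.+2%:Z by lia.
      by rewrite eP /e periodic_ext_nat //; have := y02 0%N isT; lra.
    have -> : i0%:Z + 1 = i0.+1%:Z by lia.
    by rewrite /e periodic_ext_nat //; have := y02 i0.+1 lt; lra.
  have i1 : (i.+1 < n.+2)%N by rewrite ltnS.
  rewrite lx /gap (ptx _ i1) (ptx _ (ltnW i1)).
  by have -> : i0%:Z + 1 + i.+1%:Z = i0%:Z + 1 + i%:Z + 1 by lia.
rewrite -sA; apply: val_inj => /=.
transitivity (range (circle \o e)).
  have zP i : e (i0%:Z + 1 + (i + n.+2%:Z)) = e (i0%:Z + 1 + i) + 2 * pi.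
    by rewrite addrA eP.
  transitivity (range (circle \o (fun i => e (i0%:Z + 1 + i)))).
    by rewrite -(periodic_image (ltn0Sn _) (leqnn _) zP).
  apply/seteqP; split=> _ [i _ <-] /=; first by exists (i0%:Z + 1 + i).
  by exists (i - (i0%:Z + 1)) => //=; rewrite addrC subrK.
rewrite -(periodic_image (ltn0Sn _) (leqnn _) eP).
apply/seteqP; split=> _ [i _ <-].
  rewrite /e periodic_ext_nat //; have [j ->] := y_of i (ltn_ord i).
  by exists j => //; have [] := aP j.
have [j _ E] := of_y i; exists j => //.
by rewrite /e periodic_ext_nat // E; have [] := aP i.
Qed.

(** All gaps are at most 2 pi, so the default value does not lower the minimum. *)
Definition min_gap x : R := \big[Num.min/2 * pi]_(i < n.+1) gap x i.
(** This is 0 on configurations of n + 1 points, and 1 as soon as the smallest gap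
is not unique. *)
Definition gap_ratio x : R := last_gap x / min_gap x.
Definition pt_sum x : R := \sum_(i < n.+2) pt x i.
(** The angle opposite to an average of the points, which for a core configuration
is the centre of its closing gap.  When the ratio is 0 the first and the last
angle are lifts of one point and share the weight of a single one, so that the
average is that of n + 1 points; when the ratio is 1 it is that of n + 2 points.
Relisting the points from another one moves the average by a multiple of
2 pi / (n + 1) in the first case and of 2 pi / (n + 2) in the second. *)
Definition base_angle x : R :=
  (1 - gap_ratio x) * ((pt_sum x - (pt x 0 + pt x n.+1) / 2) / n.+1%:R - pi) +
  gap_ratio x * (pt_sum x / n.+2%:R - pi).

(** All gaps are 2 pi / (n + 1 + l), except the closing one, which is l times as
large and centred at t. *)
Definition core_lift t l : lift :=
  fun i => t + (l / 2 + i%:R) * (2 * pi / (n.+1%:R + l)).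

(** The identifications in the double mapping cylinder of the circle maps of
degrees n + 1 (at l = 0) and n + 2 (at l = 1). *)
Definition core_eq t l t' l' := l = l' /\
  [\/ same_angle t' t, l = 0 /\ exists m : int, t' = t + m%:~R * (2 * pi) / n.+1%:R
    | l = 1 /\ exists m : int, t' = t + m%:~R * (2 * pi) / n.+2%:R].

Lemma min_gap_gt0 x : balanced x -> 0 < min_gap x.
Proof.
move=> bx; rewrite /min_gap; elim/big_ind: _ => [|y z y0 z0|i _].
- by rewrite mulr_gt0 ?pi_gt0.
- by rewrite lt_min y0.
- by have [] := bx i.
Qed.

Lemma last_gap_le_min x : balanced x -> last_gap x <= min_gap x.
Proof.
move=> bx; rewrite /min_gap; elim/big_ind: _ => [|y z y0 z0|i _].
- have := @pt_monotone x (fun i => ltW (bx i).1) 0%N n.+1 (leqnn _).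
  by rewrite /last_gap; lra.
- by rewrite le_min y0.
- by have [_ /andP[]] := bx i.
Qed.

Lemma gap_ratio_bounds x : balanced x -> 0 <= gap_ratio x <= 1.
Proof.
move=> bx; have m0 := min_gap_gt0 bx; have [_ /andP[g0 _]] := bx ord0.
by rewrite divr_ge0 ?(ltW m0) //= ler_pdivrMr // mul1r last_gap_le_min.
Qed.

Lemma gap_ratio1 x (i : 'I_n.+1) : balanced x -> gap x i = last_gap x -> gap_ratio x = 1.
Proof.
move=> bx E; have m0 := min_gap_gt0 bx.
rewrite /gap_ratio; suff -> : min_gap x = last_gap x.
  by rewrite divff // -E gt_eqF //; have [] := bx i.
by apply/eqP; rewrite eq_le last_gap_le_min // andbT -E bigmin_le.
Qed.

Lemma gap_ratio0 x : last_gap x = 0 -> gap_ratio x = 0.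
Proof. by rewrite /gap_ratio => ->; rewrite mul0r. Qed.

Lemma pt_core t l i : (i < n.+2)%N ->
  pt (core_lift t l) i = t + (l / 2 + i%:R) * (2 * pi / (n.+1%:R + l)).
Proof. by move=> ik; rewrite /pt /core_lift inordK. Qed.

Lemma gap_core t l (i : 'I_n.+1) : gap (core_lift t l) i = 2 * pi / (n.+1%:R + l).
Proof.
have i1 : (i.+1 < n.+2)%N by rewrite ltnS.
rewrite /gap (pt_core t l i1) (pt_core t l (ltnW i1)) -[i.+1%:R]natr1; ring.
Qed.

Lemma last_gap_core t l : 0 <= l ->
  last_gap (core_lift t l) = l * (2 * pi / (n.+1%:R + l)).
Proof.
move=> l0; rewrite /last_gap !pt_core // mulr0n addr0.
have d0 : n.+1%:R + l != 0 by rewrite gt_eqF // ltr_wpDr // ltr0n.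
have E : 2 * pi = (n.+1%:R + l) * (2 * pi / (n.+1%:R + l)) by rewrite mulrCA divff // mulr1.
rewrite [X in _ + X - _]E; ring.
Qed.

Lemma core_step_gt0 l : 0 <= l -> 0 < 2 * pi / (n.+1%:R + l) :> R.
Proof. by move=> l0; rewrite divr_gt0 ?mulr_gt0 ?pi_gt0 // ltr_wpDr ?ltr0n. Qed.

Lemma core_balanced t l : 0 <= l <= 1 -> balanced (core_lift t l).
Proof.
move=> /andP[l0 l1] i; rewrite gap_core last_gap_core //.
have := core_step_gt0 l0; set d := _ / _ => d0; split=> //.
by rewrite mulr_ge0 // ?(ltW d0) //= ler_piMl // ltW.
Qed.

Lemma gap_ratio_core t l : 0 <= l <= 1 -> gap_ratio (core_lift t l) = l.
Proof.
move=> /andP[l0 l1]; have d0 := core_step_gt0 l0.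
suff E : min_gap (core_lift t l) = 2 * pi / (n.+1%:R + l).
  by rewrite /gap_ratio E last_gap_core // mulfK // gt_eqF.
apply/eqP; rewrite eq_le; apply/andP; split.
  by rewrite -(gap_core t l ord0) bigmin_le.
rewrite /min_gap; elim/big_ind: _ => [|y z y0 z0|i _]; last by rewrite gap_core.
  rewrite ler_pdivrMr; last by rewrite ltr_wpDr ?ltr0n.
  rewrite ler_peMr // ?mulr_ge0 ?pi_ge0 //.
  by rewrite -natr1; have : 0 <= n%:R :> R by []; lra.
by rewrite le_min y0.
Qed.

Lemma base_angle_core t l : 0 <= l <= 1 -> base_angle (core_lift t l) = t.
Proof.
move=> l01; rewrite /base_angle gap_ratio_core //.
have /andP[l0 l1] := l01.
have d0 : n.+1%:R + l != 0 by rewrite gt_eqF // ltr_wpDr // ltr0n.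
have n0 : n.+1%:R != 0 :> R by rewrite pnatr_eq0.
have n0' : n.+2%:R != 0 :> R by rewrite pnatr_eq0.
have S : pt_sum (core_lift t l) = n.+2%:R * (t + pi).
  rewrite /pt_sum (eq_bigr (fun i : 'I_n.+2 =>
      t + (l / 2) * (2 * pi / (n.+1%:R + l)) + (2 * pi / (n.+1%:R + l)) * i%:R)).
    rewrite big_split /= sumr_const card_ord -mulr_sumr sum_ord_natr.
    rewrite -mulr_natl -[n.+2%:R]natr1; field.
    by rewrite [1 + n%:R]addrC natr1.
  by move=> i _; rewrite pt_core //; ring.
rewrite S !pt_core // mulr0n addr0 -[n.+2%:R]natr1; field.
by rewrite [1 + n%:R]addrC !natr1 n0 n0' d0.
Qed.

End Lifts.
Arguments core_lift {R} n t l.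

(** * Different lifts of the same configuration *)

Section Ambiguity.
Context (R : realType) (n : nat).
Local Notation lift := (prod_topology (fun _ : 'I_n.+2 => R)).
Local Notation config := (exp_space n.+2 (sphere R 1)).
Implicit Types (x : lift) (t l u : R).

(** The number of points of the configuration. *)
Definition period x := if last_gap x == 0 then n.+1 else n.+2.

Lemma period_increasing x : balanced x -> increasing_lift (period x) (pt x).
Proof.
move=> bx; rewrite /period; case: eqP => [l0|l0]; split=> // r rn.
  rewrite /cyclic_gap; case: ltnP => lt; first exact: (bx (Ordinal rn)).1.
  have := (bx (Ordinal rn)).1; rewrite /gap /=; move: l0; rewrite /last_gap.
  have -> : r = n by lia.
  lra.
rewrite pt_cyclic_gap //; case: ltnP => lt; first exact: (bx (Ordinal lt)).1.
by have [_ /andP[]] := bx ord0; lra.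
Qed.

Lemma period_points x : balanced x ->
  range (fun i : 'I_(period x) => circle (pt x i)) =
  range (fun i : 'I_n.+2 => circle (pt x i)).
Proof.
move=> bx; rewrite /period; case: eqP => // l0.
apply/seteqP; split=> _ [i _ <-]; first by exists (widen_ord (leqnSn _) i).
have [lt|ge] := ltnP i n.+1; first by exists (Ordinal lt).
exists ord0 => //; apply/circleP; exists (-1); rewrite rmorphN /=.
have -> : nat_of_ord i = n.+1 by have := ltn_ord i; lia.
by move: l0; rewrite /last_gap; lra.
Qed.

(** The periodic extensions of x and x' are shifts of each other.  For n + 1
points this is the second case.  For n + 2 points the closing gaps of x and x' are both
smallest gaps of the configuration: if the shift is a multiple of n + 2 they
coincide and x' is a translate of x, and otherwise the smallest gap is not
unique and both ratios are 1. *)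
Lemma lift_ambiguity x x' : balanced x -> balanced x' -> points x = points x' ->
  [\/ exists m : int, forall i, (i < n.+2)%N -> pt x' i = pt x i + m%:~R * (2 * pi),
      [/\ last_gap x = 0, last_gap x' = 0 & exists m : int,
         forall i, periodic_ext n.+1 (pt x') i = periodic_ext n.+1 (pt x) (i + m)]
    | [/\ gap_ratio x = 1, gap_ratio x' = 1 & exists m : int,
         forall i, periodic_ext n.+2 (pt x') i = periodic_ext n.+2 (pt x) (i + m)]].
Proof.
move=> bx bx' /pointsP; rewrite -!period_points // => E.
have [pp] := same_image_shift (period_increasing bx) (period_increasing bx') E.
move: pp; rewrite /period.
case: eqP => lx; case: eqP => lx' //= pp; try (by exfalso; lia); move=> [m mE].
  by apply: Or32; split=> //; exists m.
have n2 : (0 < n.+2)%N by [].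
have per (y : nat -> R) := periodic_mul (fun i => periodic_extD y i n2).
have mE' i : periodic_ext n.+2 (pt x) i = periodic_ext n.+2 (pt x') (i - m) by rewrite mE subrK.
pose r := `|(m %% n.+2)%Z|%N; set q := (m %/ n.+2)%Z.
have rn : (r < n.+2)%N by rewrite /r; lia.
have iE : m = r%:Z + q * n.+2%:Z.
  by rewrite /r gez0_abs ?modz_ge0 //; first rewrite addrC -divz_eq //; lia.
have [r0|r0] := posnP r.
  apply: Or31; exists q => i ik; rewrite -(periodic_ext_nat (pt x') ik) mE iE r0 add0r per.
  by rewrite periodic_ext_nat.
(* the shift is not a multiple of n + 2, so the closing gaps of x and x' are two
   different smallest gaps *)
have lastE (y : lift) : last_gap y = periodic_ext n.+2 (pt y) 0 - periodic_ext n.+2 (pt y) (-1).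
  have := periodic_ext_gap_nat (pt y) (ltnSn n.+1); rewrite pt_cyclic_gap // ltnn => <-.
  have -> : n.+1%:Z + 1 = 0 + 1 * n.+2%:Z by lia.
  have -> : n.+1%:Z = -1 + 1 * n.+2%:Z by lia.
  by rewrite !per; ring.
have le (y : lift) i : balanced y ->
    last_gap y <= periodic_ext n.+2 (pt y) (i + 1) - periodic_ext n.+2 (pt y) i.
  move=> bj; have [s sn ->] := periodic_ext_gap (pt y) i n2; rewrite pt_cyclic_gap //.
  by case: ltnP => // lt; have [_ /andP[]] := bj (Ordinal lt).
have lE : last_gap x = last_gap x'.
  apply/eqP; rewrite eq_le; apply/andP; split.
    rewrite [leRHS]lastE !mE add0r; have := le x (-1 + m) bx.
    by have -> : -1 + m + 1 = m by lia.
  rewrite [leRHS]lastE !mE' add0r; have := le x' (-1 - m) bx'.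
  by have -> : -1 - m + 1 = - m by lia.
have tie (y : lift) s : balanced y -> (0 < s < n.+2)%N ->
    periodic_ext n.+2 (pt y) s%:Z - periodic_ext n.+2 (pt y) (s%:Z - 1) = last_gap y ->
    gap_ratio y = 1.
  move=> bj /andP[s0 sn] sE; have s1 : (s.-1 < n.+1)%N by lia.
  apply: (@gap_ratio1 _ _ _ (Ordinal s1)) => //; rewrite -sE /gap /=.
  rewrite -!(@periodic_ext_nat _ n.+2 (pt y)); [|lia|lia].
  by congr (periodic_ext _ _ _ - periodic_ext _ _ _); lia.
apply: Or33; split; last by exists m.
- apply: (tie x r bx); first by rewrite r0.
  rewrite lE lastE !mE add0r.
  have -> : -1 + m = (r%:Z - 1) + q * n.+2%:Z by lia.
  by rewrite [in X in _ = X - _]iE !per; ring.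
- apply: (tie x' (n.+2 - r)%N bx'); first lia.
  rewrite -lE lastE !mE' add0r.
  have -> : -1 - m = (n.+2 - r)%:Z - 1 + (- q - 1) * n.+2%:Z by lia.
  have -> : - m = (n.+2 - r)%:Z + (- q - 1) * n.+2%:Z by lia.
  by rewrite !per; ring.
Qed.

Lemma pt_sum_recr x : pt_sum x = \sum_(i < n.+1) pt x i + pt x n.+1.
Proof. by rewrite /pt_sum big_ord_recr. Qed.

(** The shift m that relates the lists also governs their base angles, which
makes core_segment independent of the lift. *)
Lemma core_ambiguity x x' : balanced x -> balanced x' -> points x = points x' ->
  gap_ratio x = gap_ratio x' /\ exists m : int,
  [\/ (forall i, (i < n.+2)%N -> pt x' i = pt x i + m%:~R * (2 * pi)) /\
        base_angle x' = base_angle x + m%:~R * (2 * pi),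
      [/\ gap_ratio x = 0, last_gap x = 0,
        forall i, periodic_ext n.+1 (pt x') i = periodic_ext n.+1 (pt x) (i + m)
        & base_angle x' = base_angle x + m%:~R * (2 * pi) / n.+1%:R]
    | [/\ gap_ratio x = 1,
        forall i, periodic_ext n.+2 (pt x') i = periodic_ext n.+2 (pt x) (i + m)
        & base_angle x' = base_angle x + m%:~R * (2 * pi) / n.+2%:R]].
Proof.
move=> bx bx' E; have n1 : n.+1%:R != 0 :> R by rewrite pnatr_eq0.
have n2 : n.+2%:R != 0 :> R by rewrite pnatr_eq0.
have [[m mE]|[l0 l0' [m mE]]|[r1 r1' [m mE]]] := lift_ambiguity bx bx' E.
- have rr : gap_ratio x = gap_ratio x'.
    rewrite /gap_ratio; congr (_ / _); first by rewrite /last_gap !mE //; ring.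
    apply: eq_bigr => i _; have i1 : (i.+1 < n.+2)%N by rewrite ltnS.
    by rewrite /gap (mE _ i1) (mE _ (ltnW i1)); ring.
  split=> //; exists m; apply: Or31; split=> //; rewrite /base_angle -rr.
  have -> : pt_sum x' = pt_sum x + n.+2%:R * (m%:~R * (2 * pi)).
    rewrite /pt_sum (eq_bigr (fun i : 'I_n.+2 => pt x i + m%:~R * (2 * pi))).
      by rewrite big_split /= sumr_const card_ord -[in LHS](mulr_natl _ n.+2).
    by move=> i _; rewrite mE.
  rewrite !mE // -[n.+2%:R]natr1; field.
  by rewrite [1 + n%:R]addrC !natr1 n1 n2.
- have rx := gap_ratio0 l0; have rx' := gap_ratio0 l0'.
  split; first by rewrite rx rx'.
  exists m; apply: Or32; split=> //; rewrite /base_angle rx rx' !pt_sum_recr.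
  have S : \sum_(i < n.+1) pt x' i = \sum_(i < n.+1) pt x i + m%:~R * (2 * pi).
    transitivity (\sum_(i < n.+1) periodic_ext n.+1 (pt x) (i%:Z + m)).
      by apply: eq_bigr => i _; rewrite -mE periodic_ext_nat.
    rewrite periodic_sum; last by move=> i; apply: periodic_extD.
    by congr (_ + _); apply: eq_bigr => i _; rewrite periodic_ext_nat.
  rewrite S; move: l0 l0'; rewrite /last_gap => /eqP; rewrite subr_eq0 => /eqP <-.
  move=> /eqP; rewrite subr_eq0 => /eqP <-; field.
  by rewrite nat1r -natrD !pnatr_eq0.
- split; first by rewrite r1 r1'.
  exists m; apply: Or33; split=> //; rewrite /base_angle r1 r1'.
  have -> : pt_sum x' = pt_sum x + m%:~R * (2 * pi).
    transitivity (\sum_(i < n.+2) periodic_ext n.+2 (pt x) (i%:Z + m)).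
      by apply: eq_bigr => i _; rewrite -mE periodic_ext_nat.
    rewrite periodic_sum; last by move=> i; apply: periodic_extD.
    by congr (_ + _); apply: eq_bigr => i _; rewrite periodic_ext_nat.
  by rewrite subrr !mul0r !add0r; field.
Qed.

Lemma core_eq_of_points x x' : balanced x -> balanced x' -> points x = points x' ->
  core_eq n (base_angle x) (gap_ratio x) (base_angle x') (gap_ratio x').
Proof.
move=> bx bx' E; have [rr [m H]] := core_ambiguity bx bx' E; split=> //.
case: H => [[_ ->]|[r0 _ _ ->]|[r1 _ ->]]; first by apply: Or31; exists m.
  by apply: Or32; split=> //; exists m.
by apply: Or33; split=> //; exists m.
Qed.

Lemma points_periodic x p z : (0 < p <= n.+2)%N ->
  (forall i : int, z (i + p%:Z) = z i + 2 * pi) ->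
  (forall i : 'I_n.+2, pt x i = z i%:Z) ->
  \val (points x) = range (circle \o z).
Proof.
move=> /andP[p0 pn] zp xz; rewrite -(periodic_image p0 pn zp) /=.
by congr image; apply/funext => i; rewrite -xz /pt inord_val.
Qed.

(** A list extracted from a periodic sequence represents the image of the whole
sequence, and this image ignores shifts of the index. *)
Lemma points_shift x x' p z (m : int) : (0 < p <= n.+2)%N ->
  (forall i : int, z (i + p%:Z) = z i + 2 * pi) ->
  (forall i : 'I_n.+2, pt x i = z i%:Z) ->
  (forall i : 'I_n.+2, pt x' i = z (i%:Z + m)) -> points x = points x'.
Proof.
move=> pn zp xz xz'; apply: val_inj; rewrite (points_periodic pn zp xz).
rewrite (points_periodic (z := fun i => z (i + m)) pn _ xz'); last first.
  by move=> i /=; rewrite addrAC zp.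
apply/seteqP; split=> _ [i _ <-]; last by exists (i + m).
by exists (i - m) => //=; rewrite subrK.
Qed.

Lemma points_same_angle x x' : (forall i : 'I_n.+2, same_angle (pt x i) (pt x' i)) ->
  points x = points x'.
Proof.
by move=> H; apply/pointsP; congr image; apply/funext => i; apply/circleP.
Qed.

Lemma core_points_eq t l t' l' : core_eq n t l t' l' ->
  points (core_lift n t l) = points (core_lift n t' l').
Proof.
have n1 : n.+1%:R != 0 :> R by rewrite pnatr_eq0.
have n2 : n.+2%:R != 0 :> R by rewrite pnatr_eq0.
move=> [<- [tt|[-> [m ->]]|[-> [m ->]]]].
- apply: points_same_angle => i; rewrite !pt_core //; apply: same_angleD.
    exact: same_angle_sym.
  exact: same_angle_refl.
- apply: (@points_shift _ _ n.+1 (fun i => t + i%:~R * (2 * pi / n.+1%:R)) m).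
  + by rewrite leqnSn.
  + by move=> i; rewrite rmorphD /= -pmulrn; field.
  + by move=> i; rewrite pt_core // -pmulrn; field.
  + by move=> i; rewrite pt_core // rmorphD /= -pmulrn; field.
- apply: (@points_shift _ _ n.+2 (fun i => t + (1 / 2 + i%:~R) * (2 * pi / n.+2%:R)) m).
  + by rewrite leqnn.
  + by move=> i; rewrite rmorphD /= -pmulrn; field.
  + by move=> i; rewrite pt_core // -pmulrn natr1; field.
  + by move=> i; rewrite pt_core // rmorphD /= -pmulrn natr1; field.
Qed.

(** The segment from a lift to its core configuration, which has the same base
angle and ratio. *)
Definition core_segment x u : lift := fun i =>
  (1 - u) * x i + u * core_lift n (base_angle x) (gap_ratio x) i.

Lemma pt_core_segment x u i :
  pt (core_segment x u) i =
  (1 - u) * pt x i + u * pt (core_lift n (base_angle x) (gap_ratio x)) i.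
Proof. by []. Qed.

(** In each case of core_ambiguity the core lists are related by the same shift as
the given lists, so their convex combinations are as well. *)
Lemma core_segment_points_eq x x' u : balanced x -> balanced x' -> points x = points x' ->
  points (core_segment x u) = points (core_segment x' u).
Proof.
move=> bx bx' E; have n1 : n.+1%:R != 0 :> R by rewrite pnatr_eq0.
have n2 : n.+2%:R != 0 :> R by rewrite pnatr_eq0.
have [rr [m H]] := core_ambiguity bx bx' E.
case: H => [[mE bE]|[r0 l0 mE bE]|[r1 mE bE]].
- apply: points_same_angle => i; apply: same_angle_sym; exists m.
  by rewrite !pt_core_segment !pt_core // -rr bE mE //; ring.
- pose z i := (1 - u) * periodic_ext n.+1 (pt x) i +
    u * (base_angle x + i%:~R * (2 * pi / n.+1%:R)).
  have extE (y : lift) (i : 'I_n.+2) : last_gap y = 0 -> pt y i = periodic_ext n.+1 (pt y) i%:Z.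
    move=> ly; have [lt|ge] := ltnP i n.+1; first by rewrite periodic_ext_nat.
    have -> : nat_of_ord i = n.+1 by have := ltn_ord i; lia.
    have -> : n.+1%:Z = 0 + n.+1%:Z by lia.
    by rewrite periodic_extD // periodic_ext_nat //; move: ly; rewrite /last_gap; lra.
  apply: (@points_shift _ _ n.+1 z m).
  + by rewrite leqnSn.
  + by move=> i; rewrite /z periodic_extD // rmorphD /= -pmulrn; field.
  + by move=> i; rewrite pt_core_segment pt_core // extE // r0 /z -pmulrn; field.
  + have l0' : last_gap x' = 0.
      have := min_gap_gt0 bx'; move: rr; rewrite r0 /gap_ratio => /esym/eqP.
      by rewrite mulf_eq0 invr_eq0 => /orP[/eqP//|/eqP ->]; rewrite ltxx.
    move=> i; rewrite pt_core_segment pt_core // (extE x') // mE -rr r0 bE /z rmorphD /= -pmulrn.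
    by field.
- pose z i := (1 - u) * periodic_ext n.+2 (pt x) i +
    u * (base_angle x + (1 / 2 + i%:~R) * (2 * pi / n.+2%:R)).
  apply: (@points_shift _ _ n.+2 z m).
  + by rewrite leqnn.
  + by move=> i; rewrite /z periodic_extD // rmorphD /= -pmulrn; field.
  + move=> i; rewrite pt_core_segment pt_core // -(periodic_ext_nat (pt x) (ltn_ord i)).
    by rewrite r1 /z -pmulrn natr1; field.
  + move=> i; rewrite pt_core_segment pt_core // -(periodic_ext_nat (pt x') (ltn_ord i)).
    by rewrite mE -rr r1 bE /z rmorphD /= -pmulrn natr1; field.
Qed.

(** The conditions defining balanced lists are linear in the gaps. *)
Lemma core_segment_balanced x u : balanced x -> 0 <= u <= 1 -> balanced (core_segment x u).
Proof.
move=> bx u01 i; have [g0 /andP[l0 lg]] := bx i.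
have [g0' /andP[l0' lg']] := core_balanced (base_angle x) (gap_ratio_bounds bx) i.
have gE : gap (core_segment x u) i =
    (1 - u) * gap x i + u * gap (core_lift n (base_angle x) (gap_ratio x)) i.
  have i1 : (i.+1 < n.+2)%N by rewrite ltnS.
  by rewrite /gap !pt_core_segment; ring.
have lE : last_gap (core_segment x u) =
    (1 - u) * last_gap x + u * last_gap (core_lift n (base_angle x) (gap_ratio x)).
  by rewrite /last_gap !pt_core_segment; ring.
rewrite gE lE; nra.
Qed.

End Ambiguity.

(** * The presentation of the space of configurations *)

Section LiftContinuity.
Context (R : realType) (n : nat).
Local Notation lift := (prod_topology (fun _ : 'I_n.+2 => R)).
Local Notation config := (exp_space n.+2 (sphere R 1)).
Implicit Types (x : lift) (t l u : R).

Lemma at_pt i x : {for x, continuous (fun y : lift => pt y i)}.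
Proof. exact: (@proj_continuous _ (fun=> R) (inord i)). Qed.

Lemma at_gap i x : {for x, continuous (fun y : lift => gap y i)}.
Proof. by rewrite /gap; at_tac; exact: at_pt. Qed.

Lemma at_last_gap x : {for x, continuous (@last_gap R n)}.
Proof. by rewrite /last_gap; at_tac; exact: at_pt. Qed.

Lemma at_gap_ratio x : balanced x -> {for x, continuous (@gap_ratio R n)}.
Proof.
move=> bx; rewrite /gap_ratio; apply: atM; first exact: at_last_gap.
apply: atV; first by rewrite gt_eqF // min_gap_gt0.
by apply: at_bigmin => i; exact: at_gap.
Qed.

Lemma at_base_angle x : balanced x -> {for x, continuous (@base_angle R n)}.
Proof.
move=> bx; have c := at_gap_ratio bx; rewrite /base_angle.
have cs : {for x, continuous (@pt_sum R n)}.
  by apply: at_sum => i; exact: at_pt.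
by at_tac; exact: at_pt.
Qed.

Lemma at_points (T : topologicalType) (f : T -> lift) (a : T) :
  (forall i, {for a, continuous (fun b => f b i)}) ->
  {for a, continuous (fun b => points (f b))}.
Proof.
move=> cf; apply: (at_comp (@exp_proj_continuous _ _ (ltn0Sn n.+1))).
apply: tuple_continuous => i; apply: (at_comp (@circle_continuous R)).
exact: cf.
Qed.

Lemma at_core (T : topologicalType) (f g : T -> R) (a : T) :
  0 <= g a -> {for a, continuous f} -> {for a, continuous g} ->
  forall i, {for a, continuous (fun b => core_lift n (f b) (g b) i)}.
Proof.
move=> g0 cf cg i; rewrite /core_lift; at_tac.
apply: atV; at_tac; by rewrite gt_eqF // ltr_wpDr // ltr0n.
Qed.

Lemma at_core_segment x u : balanced x ->
  {for (x, u), continuous (fun p : lift * R => points (core_segment p.1 p.2))}.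
Proof.
move=> bx; apply: at_points => i; rewrite /core_segment.
have c1 : {for (x, u), continuous (@fst lift R)} by exact: cvg_fst.
have c2 : {for (x, u), continuous (@snd lift R)} by exact: cvg_snd.
have cx : {for (x, u), continuous (fun p : lift * R => p.1 i)}.
  apply: (@continuous_comp _ _ _ fst (fun y : lift => y i)) => //.
  exact: (@proj_continuous _ (fun=> R) i).
have cb : {for (x, u), continuous (fun p : lift * R => base_angle p.1)}.
  by apply: continuous_comp => //; exact: at_base_angle.
have cr : {for (x, u), continuous (fun p : lift * R => gap_ratio p.1)}.
  by apply: continuous_comp => //; exact: at_gap_ratio.
have cc : {for (x, u), continuous
    (fun p : lift * R => core_lift n (base_angle p.1) (gap_ratio p.1) i)}.
  by apply: at_core => //=; have /andP[] := gap_ratio_bounds bx.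
by at_tac.
Qed.

Lemma lift_box_compact : compact (@lift_box R n).
Proof.
pose B := [set x : lift | forall i, `[0, 6 * pi : R]%classic (x i)].
have cB : compact B.
  exact: (@tychonoff 'I_n.+2 (fun=> R) _ (fun _ => @segment_compact _ 0 (6 * pi))).
apply: subclosed_compact cB _.
  have cl (f : lift -> R) : (forall x, {for x, continuous f}) -> closed [set x | 0 <= f x].
    by move=> /continuous_closedP cf; apply: (cf [set y | 0 <= y]); exact: closed_ge.
  rewrite (_ : @lift_box R n = [set x | 0 <= pt x 0] `&` ([set x | 0 <= 4 * pi - pt x 0] `&`
      ([set x | 0 <= last_gap x] `&`
       \bigcap_(i : 'I_n.+1) [set x | 0 <= gap x i - last_gap x]))).
    apply: closedI; first by apply: cl => x; exact: at_pt.
    apply: closedI; first by apply: cl => x; have ? := @at_pt 0 x; at_tac.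
    apply: closedI; first by apply: cl => x; exact: at_last_gap.
    apply: closed_bigI => i _; apply: cl => x.
    have ? := @at_gap i x; have ? := @at_last_gap x; at_tac.
  apply/seteqP; split=> x; rewrite /lift_box /=.
    move=> [/andP[x0 x4] H]; split=> //; split; first by rewrite subr_ge0.
    split; first by have /andP[] := H ord0.
    by move=> i _ /=; rewrite subr_ge0; have /andP[] := H i.
  move=> [x0 [x4 [l0 H]]]; split; first by rewrite x0 -subr_ge0.
  by move=> i; rewrite l0 -subr_ge0; exact: H.
move=> x [/andP[x0 x4] H] i; rewrite /= in_itv /=.
have g0 (j : 'I_n.+1) : 0 <= gap x j by have /andP[] := H j; lra.
have xi : x i = pt x i by rewrite /pt inord_val.
have in1 : (i <= n.+1)%N by rewrite -ltnS.
have := pt_monotone g0 (i := 0%N) (j := i) in1.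
have := pt_monotone g0 (i := i) (j := n.+1); rewrite in1 leqnn => /(_ isT).
have /andP[+ _] := H ord0; rewrite /last_gap xi; lra.
Qed.

Lemma points_presents :
  presents (@points R n) (@balanced R n) (~` exp_sub n.+2 n (sphere R 1)).
Proof.
split.
- move=> x; apply: (@at_points lift id) => i; exact: (@proj_continuous _ (fun=> R) i).
- move=> x bx; apply: balanced_many_points => [i|]; first by have [] := bx i.
  by have [_ /andP[]] := bx ord0.
exists (@lift_box R n); split; first exact: lift_box_compact.
  by move=> x bx; apply: contra_notP; exact: degenerate_few_points.
by move=> A _; exact: lift_surj.
Qed.

End LiftContinuity.

(** * Retraction of the punctured square *)

Section Weight.
Context (R : realFieldType).
Implicit Types s m : R.

Definition upper s m := Num.max 0 ((1 - `|s|) / 2 + (m - 1 / 2)).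
Definition lower s m := Num.max 0 ((1 - `|s|) / 2 - (m - 1 / 2)).
(** A retraction of the square [-1, 1] x [0, 1] without the points (1, 1/2) and
(-1, 1/2) onto the segment s = 0, as the height of the image.  It is 0 on the
bottom side and on the vertical sides below the missing points, and 1 on the top
side and on the vertical sides above them. *)
Definition weight s m := upper s m / (upper s m + lower s m).

Definition admissible s m := [/\ `|s| <= 1, 0 <= m <= 1 & ~ (`|s| = 1 /\ m = 1 / 2)].

Lemma upper_lower_gt0 s m : admissible s m -> 0 < upper s m + lower s m.
Proof.
move=> [s1 m01 ne].
have u0 : 0 <= upper s m by rewrite le_max lexx.
have l0 : 0 <= lower s m by rewrite le_max lexx.
have u1 : (1 - `|s|) / 2 + (m - 1 / 2) <= upper s m by rewrite le_max lexx orbT.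
have l1 : (1 - `|s|) / 2 - (m - 1 / 2) <= lower s m by rewrite le_max lexx orbT.
have [s1'|s1'] := ltP `|s| 1; first lra.
have s1E : `|s| = 1 by lra.
have : m != 1 / 2 by apply/eqP => mE; apply: ne.
by rewrite neq_lt => /orP[]; lra.
Qed.

Lemma weight_bounds s m : admissible s m -> 0 <= weight s m <= 1.
Proof.
move=> ad; have p := upper_lower_gt0 ad; rewrite /weight.
have u0 : 0 <= upper s m by rewrite le_max lexx.
have l0 : 0 <= lower s m by rewrite le_max lexx.
by rewrite divr_ge0 ?(ltW p) //= ler_pdivrMr // mul1r lerDl.
Qed.

Lemma weight_lower s m : admissible s m -> m = 0 \/ `|s| = 1 /\ m < 1 / 2 ->
  weight s m = 0.
Proof.
move=> [s1 _ _] H; rewrite /weight (_ : upper s m = 0) ?mul0r //.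
by rewrite /upper; apply/max_idPl; have := normr_ge0 s; case: H => [->|[-> ?]]; lra.
Qed.

Lemma weight_upper s m : admissible s m -> m = 1 \/ `|s| = 1 /\ 1 / 2 < m ->
  weight s m = 1.
Proof.
move=> ad H; have p := upper_lower_gt0 ad; have [s1 _ _] := ad.
have l0 : lower s m = 0.
  by rewrite /lower; apply/max_idPl; have := normr_ge0 s; case: H => [->|[-> ?]]; lra.
by move: p; rewrite /weight l0 addr0 => p; rewrite divff // gt_eqF.
Qed.

Lemma weight_middle m : 0 <= m <= 1 -> weight 0 m = m.
Proof.
move=> m01; rewrite /weight /upper /lower normr0.
have -> : Num.max 0 ((1 - 0) / 2 + (m - 1 / 2)) = m by rewrite max_r; lra.
have -> : Num.max 0 ((1 - 0) / 2 - (m - 1 / 2)) = 1 - m by rewrite max_r; lra.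
by rewrite addrC subrK divr1.
Qed.

Lemma weightN s m : weight (- s) m = weight s m.
Proof. by rewrite /weight /upper /lower normrN. Qed.

Lemma weight_edge s m : admissible s m -> `|s| = 1 ->
  m < 1 / 2 /\ weight s m = 0 \/ 1 / 2 < m /\ weight s m = 1.
Proof.
move=> ad s1; have [_ _ ne] := ad; have [lt|gt|eq] := ltgtP m (1 / 2).
- by left; split=> //; apply: weight_lower => //; right.
- by right; split=> //; apply: weight_upper => //; right.
- by case: ne.
Qed.

End Weight.

(** * The complement of the standard torus knot *)

(* the shape in which field leaves the conditions n + 1 != 0 and n + 2 != 0 *)
Ltac nat_field := field; rewrite ?nat1r -?natrD ?pnatr_eq0.

Section TorusKnot.
Context (R : realType) (n : nat).
Local Notation params := (R * R * R)%type.
Local Notation knot := (standard_torus_knot (R := R) n.+1 n.+2).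
Implicit Types (p : params) (t s m u : R).

Definition angle1 t s := n.+1%:R * t + pi + pi * s.
Definition angle2 t s := n.+2%:R * t + pi + pi * s.
(** Here p = (t, s, m): the time t along the orbits of the flow with speeds n + 1
and n + 2, the phase pi + pi s of the orbit, and the latitude m. *)
Definition torus_point p :=
  join_point (pi * p.2 / 2) (angle1 p.1.1 p.1.2) (angle2 p.1.1 p.1.2).

Definition off_knot : set params := [set p | admissible p.1.2 p.2].

(** The time to reach when the phase moves from pi + pi s to pi.  For l = 0 the
first angle is kept, and for l = 1 the second one. *)
Definition slide t s l := t + pi * s * ((1 - l) / n.+1%:R + l / n.+2%:R).

Let n1 : n.+1%:R != 0 :> R. Proof. by rewrite pnatr_eq0. Qed.
Let n2 : n.+2%:R != 0 :> R. Proof. by rewrite pnatr_eq0. Qed.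

Lemma angle2E t s : angle2 t s = angle1 t s + t.
Proof. by rewrite /angle2 -natr1 /angle1; ring. Qed.

Lemma cos_piquarter : cos (pi / 4) = (Num.sqrt 2)^-1 :> R.
Proof.
have pi_pos := @pi_gt0 R.
have c0 : 0 < cos (pi / 4) :> R by apply: cos_gt0_pihalf; lra.
have : cos (pi / 4 *+ 2) = 0 :> R.
  by rewrite -[RHS](@cos_pihalf R); congr cos; rewrite -mulr_natr; field.
rewrite cos_mulr2n => H.
have s0 : 0 < Num.sqrt 2 :> R by rewrite sqrtr_gt0.
have s2 : Num.sqrt 2 ^+ 2 = 2 :> R by rewrite sqr_sqrtr.
apply: (mulIf (lt0r_neq0 s0)); rewrite mulVf ?lt0r_neq0 //.
apply/eqP; rewrite -(eqrXn2 (n := 2)) ?mulr_ge0 ?ltW //.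
by rewrite exprMn s2 expr1n; apply/eqP; lra.
Qed.

Lemma sin_piquarter : sin (pi / 4) = (Num.sqrt 2)^-1 :> R.
Proof.
by rewrite -cos_piquarter -[LHS]cosBpihalf -[RHS]cosN; congr cos; lra.
Qed.

Lemma knotP (y : sphere R 3) :
  knot y <-> exists t, y = join_point (pi / 4) (n.+1%:R * t) (n.+2%:R * t).
Proof.
have E t : \val (join_point (pi / 4) (n.+1%:R * t) (n.+2%:R * t)) = torus_curve n.+1 n.+2 t.
  rewrite /= /torus_curve cos_piquarter sin_piquarter; apply/rowP => j; rewrite !mxE.
  by case: j => [[|[|[|[|//]]]]].
split=> -[t yt]; exists t; first by apply: val_inj; rewrite E.
by rewrite yt E.
Qed.

(** The difference of the two angles determines t modulo 2 pi, and then the first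
angle determines pi + pi s modulo 2 pi; on the knot this phase is 0. *)
Lemma torus_point_off_knot p : off_knot p -> ~ knot (torus_point p).
Proof.
have pi_pos := @pi_gt0 R.
case: p => [[t s] m] [/= s1 m01 ne] /knotP [t0] /join_point_inj [||/= fE aE bE];
  [by apply/andP; split; rewrite /=; nra|by apply/andP; split; lra|].
have mE : m = 1 / 2.
  by apply: (mulfI (lt0r_neq0 pi_pos)); lra.
apply: ne; split=> //.
have {}aE : same_angle (angle1 t s) (n.+1%:R * t0) by apply: aE; nra.
have {}bE : same_angle (angle2 t s) (n.+2%:R * t0) by apply: bE; nra.
have tE : same_angle t t0.
  have := same_angleD bE (same_angleN aE); rewrite angle2E -[in n.+2%:R]natr1.
  by rewrite addrAC subrr add0r (_ : _ - _ = t0) //; ring.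
have [k kE] := same_angleD aE (same_angleN (same_angleMn n.+1 tE)).
have {}kE : 1 + s = k%:~R * 2.
  by apply: (mulfI (lt0r_neq0 pi_pos)); move: kE; rewrite /angle1 subrr add0r; lra.
move: s1; rewrite ler_norml => /andP[lo hi].
have k0 : -1 < k by rewrite -(ltr_int R) rmorphN /=; lra.
have k1 : k < 2 by rewrite -(ltr_int R); lra.
have [k00|k11] : k = 0 \/ k = 1 by lia.
  by move: kE; rewrite k00 => ?; rewrite (_ : s = -1) ?normrN1 //; lra.
by move: kE; rewrite k11 => ?; rewrite (_ : s = 1) ?normr1 //; lra.
Qed.

Lemma same_angle_pi s : `|s| = 1 -> same_angle (pi + pi * s) 0.
Proof.
have pi_pos := @pi_gt0 R.
move=> /eqP; rewrite eqr_norml ler01 andbT => /orP[] /eqP ->; last by exists 0; lra.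
by exists 1; lra.
Qed.

Lemma torus_point_on_knot t s : `|s| = 1 -> knot (torus_point (t, s, 1 / 2)).
Proof.
move=> s1; apply/knotP; exists t; rewrite /torus_point /=.
have -> : pi * (1 / 2) / 2 = pi / 4 :> R by field.
by apply: join_point_congr; right; rewrite /angle1 /angle2 -addrA
  -[X in same_angle _ X]addr0; apply: same_angleD (same_angle_refl _) (same_angle_pi s1).
Qed.

Lemma reduce_angle (a : R) : exists2 c, 0 <= c <= 2 * pi & same_angle c a.
Proof.
have [c c2 /circleP ca] := circle_surj (circle a).
by exists c => //; case/andP: c2 => -> /ltW.
Qed.

(** From join coordinates (f, a, b), take t congruent to b - a and then s such
that pi + pi s is congruent to a - (n + 1) t. *)
Lemma torus_point_surj (y : sphere R 3) : exists2 p, torus_point p = y &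
  [/\ 0 <= p.1.1 <= 2 * pi, -1 <= p.1.2 <= 1 & 0 <= p.2 <= 1].
Proof.
have pi_pos := @pi_gt0 R.
have [f [a [b [f01 <-]]]] := join_point_surj y.
have [t t01 tE] := reduce_angle (b - a).
have [c c01 cE] := reduce_angle (a - n.+1%:R * t).
have aE : same_angle (n.+1%:R * t + c) a.
  have E : n.+1%:R * t + (a - n.+1%:R * t) = a by ring.
  by have := same_angleD (same_angle_refl (n.+1%:R * t)) cE; rewrite E.
have p0 := lt0r_neq0 pi_pos.
exists (t, (c - pi) / pi, 2 * f / pi) => /=; last first.
  split=> //.
    by rewrite ler_pdivlMr // ler_pdivrMr //; apply/andP; split; lra.
  have /andP[f0 f1] := f01.
  by rewrite divr_ge0 ?mulr_ge0 ?(ltW pi_pos) //= ler_pdivrMr //; lra.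
rewrite /torus_point /=.
have -> : pi * (2 * f / pi) / 2 = f by rewrite mulrCA divff // mulr1 mulrC mulKf.
have fE : angle1 t ((c - pi) / pi) = n.+1%:R * t + c.
  by rewrite /angle1 mulrCA divff // mulr1; ring.
apply: join_point_congr; right; first by rewrite fE.
rewrite angle2E fE; have := same_angleD aE tE.
by rewrite (_ : a + (b - a) = b) //; ring.
Qed.

Lemma at_torus_point (T : topologicalType) (x : T) (f g h : T -> R) :
  {for x, continuous f} -> {for x, continuous g} -> {for x, continuous h} ->
  {for x, continuous (fun y => torus_point (f y, g y, h y))}.
Proof.
move=> cf cg ch; apply: set_type_continuous; apply: row_continuous => j.
set v := fun y => [:: cos (pi * h y / 2) * cos (angle1 (f y) (g y));
  cos (pi * h y / 2) * sin (angle1 (f y) (g y));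
  sin (pi * h y / 2) * cos (angle2 (f y) (g y));
  sin (pi * h y / 2) * sin (angle2 (f y) (g y))]`_j.
have -> : (fun y => \val (torus_point (f y, g y, h y)) 0 j) = v.
  by apply/funext => y; rewrite mxE.
have ca : {for x, continuous (fun y => angle1 (f y) (g y))}.
  by rewrite /angle1; at_tac.
have cb : {for x, continuous (fun y => angle2 (f y) (g y))}.
  by rewrite /angle2; at_tac.
have cm : {for x, continuous (fun y => pi * h y / 2)} by at_tac.
have C k : {for x, continuous k} -> {for x, continuous (fun y => cos (k y) : R)}.
  by move=> ck; apply: (at_comp (@continuous_cos R)).
have S k : {for x, continuous k} -> {for x, continuous (fun y => sin (k y) : R)}.
  by move=> ck; apply: (at_comp (@continuous_sin R)).
by rewrite /v; case: j {v} => [[|[|[|[|//]]]]] j /=; apply: atM;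
  (apply: C || apply: S).
Qed.

Lemma torus_point_presents : presents torus_point off_knot (~` knot).
Proof.
split; last 1 first.
- exists ((`[0, 2 * pi] `*` `[-1, 1]) `*` `[0, 1]); split.
  + by do !apply: compact_setX; exact: segment_compact.
  + case=> [[t s] m] [[/= _ s1] m01] nk; split=> /=.
    * by rewrite ler_norml; move: s1; rewrite in_itv.
    * by move: m01; rewrite in_itv.
    * by move=> [s1' mE]; apply: nk; rewrite mE; exact: torus_point_on_knot.
  + move=> y _; have [p py [t01 s1 m01]] := torus_point_surj y.
    by exists p => //; do 2?split; rewrite /= in_itv.
- move=> p; have -> : torus_point = fun q => torus_point (q.1.1, q.1.2, q.2).
    by apply/funext => -[[]].
  apply: (@at_torus_point params).
  + apply: (@continuous_comp _ _ _ (@fst (R * R)%type R) fst); exact: cvg_fst.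
  + by apply: (@continuous_comp _ _ _ (@fst (R * R)%type R) snd);
      [exact: cvg_fst|exact: cvg_snd].
  + exact: cvg_snd.
- exact: torus_point_off_knot.
Qed.

Lemma torus_point_congr t s t' s' m :
  (m = 1 \/ same_angle (angle1 t s) (angle1 t' s')) ->
  (m = 0 \/ same_angle (angle2 t s) (angle2 t' s')) ->
  torus_point (t, s, m) = torus_point (t', s', m).
Proof.
move=> H1 H2; apply: join_point_congr => /=.
  by case: H1 => [->|]; [left; rewrite mulr1 cos_pihalf|right].
by case: H2 => [->|]; [left; rewrite mulr0 mul0r sin0|right].
Qed.

(** On each of the two extreme circles only one of the angles is defined.
Elsewhere both are, hence t and the phase are known modulo 2 pi, which leaves
the choice of the sign of s when s = 1 or s = -1. *)
Lemma torus_point_ambiguity t s m t' s' m' :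
  admissible s m -> admissible s' m' ->
  torus_point (t, s, m) = torus_point (t', s', m') -> m = m' /\
  [\/ m = 0 /\ same_angle (angle1 t s) (angle1 t' s'),
      m = 1 /\ same_angle (angle2 t s) (angle2 t' s')
    | same_angle t t' /\ (s = s' \/ `|s| = 1 /\ s' = - s)].
Proof.
have pi_pos := @pi_gt0 R; have p0 := lt0r_neq0 pi_pos.
move=> [s1 m01 _] [s1' m01' _] /join_point_inj [||/= fE aE bE];
  [by apply/andP; split; rewrite /=; nra|by apply/andP; split; rewrite /=; nra|].
have mE : m = m' by apply: (mulfI p0); lra.
split=> //; subst m'; clear fE; have [m0|m0] := eqVneq m 0.
  by apply: Or31; split=> //; apply: aE; rewrite m0; lra.
have [m1|m1] := eqVneq m 1.
  by apply: Or32; split=> //; apply: bE; rewrite m1; lra.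
have {}m01 : 0 < m < 1 by move: m0 m1; rewrite !neq_lt; lra.
have {}aE : same_angle (angle1 t s) (angle1 t' s') by apply: aE; nra.
have {}bE : same_angle (angle2 t s) (angle2 t' s') by apply: bE; nra.
apply: Or33.
have tE : same_angle t t'.
  have := same_angleD bE (same_angleN aE); rewrite !angle2E.
  have E x y : x + y - x = y :> R by ring.
  by rewrite !E.
split=> //.
have [k kE] := same_angleD aE (same_angleN (same_angleMn n.+1 tE)).
have {}kE : s - s' = k%:~R * 2.
  by apply: (mulfI p0); move: kE; rewrite /angle1; lra.
move: s1 s1'; rewrite !ler_norml => /andP[lo hi] /andP[lo' hi'].
have k0 : -2 < k by rewrite -(ltr_int R) rmorphN /=; lra.
have k1 : k < 2 by rewrite -(ltr_int R); lra.
have [k00|[k00|k00]] : k = 0 \/ k = 1 \/ k = -1 by clear -k0 k1; lia.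
- by left; move: kE; rewrite k00; lra.
- right; have sE : s = 1 by move: kE; rewrite k00; lra.
  by rewrite sE normr1; split=> //; move: kE; rewrite k00; lra.
- right; have sE : s = -1 by move: kE; rewrite k00 rmorphN /=; lra.
  by rewrite sE normrN1; split=> //; move: kE; rewrite k00 rmorphN /=; lra.
Qed.

Definition to_core p := (slide p.1.1 p.1.2 (weight p.1.2 p.2), weight p.1.2 p.2).

Lemma angle1_slide t s l : l = 0 -> n.+1%:R * slide t s l = angle1 t s - pi.
Proof. by move=> ->; rewrite /slide /angle1; nat_field. Qed.

Lemma angle2_slide t s l : l = 1 -> n.+2%:R * slide t s l = angle2 t s - pi.
Proof. by move=> ->; rewrite /slide /angle2; nat_field. Qed.

Lemma core_eq_angle1 t s t' s' : same_angle (angle1 t s) (angle1 t' s') ->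
  core_eq n (slide t s 0) 0 (slide t' s' 0) 0.
Proof.
move=> /same_angle_sym [m mE]; split=> //; apply: Or32; split=> //; exists m.
apply: (mulfI n1); rewrite [RHS]mulrDr !angle1_slide // mE.
by rewrite [n.+1%:R * (_ / _)]mulrCA divff // mulr1; ring.
Qed.

Lemma core_eq_angle2 t s t' s' : same_angle (angle2 t s) (angle2 t' s') ->
  core_eq n (slide t s 1) 1 (slide t' s' 1) 1.
Proof.
move=> /same_angle_sym [m mE]; split=> //; apply: Or33; split=> //; exists m.
apply: (mulfI n2); rewrite [RHS]mulrDr !angle2_slide // mE.
by rewrite [n.+2%:R * (_ / _)]mulrCA divff // mulr1; ring.
Qed.

Lemma edge_angles t t' s : same_angle t t' -> `|s| = 1 ->
  same_angle (angle1 t s) (angle1 t' (- s)) /\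
  same_angle (angle2 t s) (angle2 t' (- s)).
Proof.
move=> tE s1; have E := same_angleD (same_angle_pi s1)
  (same_angle_sym (same_angle_pi (etrans (normrN s) s1))).
have {}E : same_angle (pi + pi * s) (pi + pi * - s) by move: E; rewrite addr0 add0r.
by split; rewrite /angle1 /angle2 -!(addrA _ pi);
  apply: same_angleD => //; apply: same_angleMn.
Qed.

(** For s = 1 or s = -1 off the knot the weight is 0 or 1, and the targets of the
two possible slides then differ by 2 pi / (n + 1), respectively 2 pi / (n + 2). *)
Lemma to_core_eq p p' : off_knot p -> off_knot p' -> torus_point p = torus_point p' ->
  core_eq n (to_core p).1 (to_core p).2 (to_core p').1 (to_core p').2.
Proof.
case: p p' => [[t s] m] [[t' s'] m'] /= ad ad' /(torus_point_ambiguity ad ad') /= [mm H].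
subst m'; rewrite /to_core /=.
case: H => [[m0 aE]|[m1 bE]|[tE [ss|[s1 ss]]]].
- by rewrite !weight_lower //; try (by left); exact: core_eq_angle1.
- by rewrite !weight_upper //; try (by left); exact: core_eq_angle2.
- subst s'; split=> //; apply: Or31; apply: same_angle_sym.
  by apply: same_angleD => //; exact: same_angle_refl.
- subst s'; rewrite weightN; have [aE bE] := edge_angles tE s1.
  by have [[_ ->]|[_ ->]] := weight_edge ad s1;
    [exact: core_eq_angle1|exact: core_eq_angle2].
Qed.

Lemma torus_point_core_eq t l t' l' : core_eq n t l t' l' ->
  torus_point (t, 0, l) = torus_point (t', 0, l').
Proof.
move=> [<- H]; apply: torus_point_congr; rewrite /angle1 /angle2.
  case: H => [tt|[-> [m ->]]|[-> _]]; [right|right|by left].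
    do 2?apply: same_angleD; try exact: same_angle_refl.
    by apply: same_angleMn; exact: same_angle_sym.
  by apply: same_angle_sym; exists m; nat_field.
case: H => [tt|[-> _]|[-> [m ->]]]; [right|by left|right].
  do 2?apply: same_angleD; try exact: same_angle_refl.
  by apply: same_angleMn; exact: same_angle_sym.
by apply: same_angle_sym; exists m; nat_field.
Qed.

(** As u decreases from 1, the latitude moves to its final value for u >= 1/2, and
the phase and the time move for u <= 1/2.  The latitude has to come first: the
lifts s = 1 and s = -1 of the same point slide in opposite directions, which is
harmless only when the point has reached one of the extreme circles, where slide
fixes the only angle that is defined. *)
Definition deform p u : params :=
  let u1 := Num.min (2 * (1 - u)) 1 in let u2 := Num.max (1 - 2 * u) 0 in
  let c := to_core p in
  (p.1.1 + u2 * (c.1 - p.1.1), (1 - u2) * p.1.2, p.2 + u1 * (c.2 - p.2)).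

Lemma deform0 p : deform p 0 = ((to_core p).1, 0, (to_core p).2).
Proof.
rewrite /deform !subr0 mulr1 mulr0 subr0 min_r ?max_l ?ler1n //.
by rewrite !mul1r subrr mul0r !(addrC _ (_ - _)) !subrK.
Qed.

Lemma deform1 p : deform p 1 = p.
Proof.
rewrite /deform subrr mulr0 min_l // max_r; last lra.
by rewrite !mul0r !addr0 subr0 mul1r; case: p => [[]].
Qed.

Lemma deform_off_knot p u : 0 <= u <= 1 -> off_knot p -> off_knot (deform p u).
Proof.
case: p => [[t s] m] u01 /= ad; have [/= s1 m01 ne] := ad.
have /= w01 := weight_bounds ad; rewrite /deform /to_core /=.
set u1 := Num.min _ _; set u2 := Num.max _ _.
have u1b : 0 <= u1 <= 1.
  by apply/andP; split; [rewrite le_min; lra|rewrite ge_min lexx orbT].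
have u2b : 0 <= u2 <= 1.
  by apply/andP; split; [rewrite le_max lexx orbT|rewrite ge_max; lra].
have us : `|(1 - u2) * s| = (1 - u2) * `|s| by rewrite normrM ger0_norm //; lra.
have s0 := normr_ge0 s.
split=> /=; [rewrite us; nra| |rewrite us => -[E mE]].
  by apply/andP; split; nra.
have s1E : `|s| = 1 by nra.
have /andP[m0 m1] := m01; have /andP[v0 v1] := u1b.
have p0 : 0 <= u1 * m by exact: mulr_ge0.
have p1 : 0 <= u1 * (1 - m) by apply: mulr_ge0 => //; lra.
by have [/= [? wE]|/= [? wE]] := weight_edge ad s1E; rewrite wE in mE; lra.
Qed.

(** On the extreme circles the deformation does not move the angle that is
defined.  The lifts s = 1 and s = -1 have moved neither in phase nor in time for
u >= 1/2, and lie on an extreme circle for u <= 1/2. *)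
Lemma deform_eq p p' u : 0 <= u <= 1 -> off_knot p -> off_knot p' ->
  torus_point p = torus_point p' -> torus_point (deform p u) = torus_point (deform p' u).
Proof.
move=> u01; case: p p' => [[t s] m] [[t' s'] m'] /= ad ad'.
move=> /(torus_point_ambiguity ad ad') /= [mm H].
subst m'; rewrite /deform /to_core /=.
set u1 := Num.min _ _; set u2 := Num.max _ _.
have angle1E' x y : angle1 (x + u2 * (slide x y 0 - x)) ((1 - u2) * y) = angle1 x y.
  by rewrite /angle1 /slide; nat_field.
have angle2E' x y : angle2 (x + u2 * (slide x y 1 - x)) ((1 - u2) * y) = angle2 x y.
  by rewrite /angle2 /slide; nat_field.
case: H => [[m0 aE]|[m1 bE]|[tE [ss|[s1 ss]]]].
- rewrite !weight_lower //; try (by left).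
  by apply: torus_point_congr; [right; rewrite !angle1E'|left; rewrite m0; ring].
- rewrite !weight_upper //; try (by left).
  by apply: torus_point_congr; [left; rewrite m1; ring|right; rewrite !angle2E'].
- subst s'; have E : same_angle (t + u2 * (slide t s (weight s m) - t))
      (t' + u2 * (slide t' s (weight s m) - t')).
    have F x l : x + u2 * (slide x s l - x) = x + u2 * (slide 0 s l).
      by rewrite /slide; ring.
    by rewrite !F; apply: same_angleD => //; exact: same_angle_refl.
  apply: torus_point_congr; right; rewrite /angle1 /angle2;
    (do 2?apply: same_angleD; try exact: same_angle_refl); exact: same_angleMn.
- subst s'; rewrite weightN; have [aE bE] := edge_angles tE s1.
  have [u20|u20] := eqVneq u2 0.
    have [w] := ex_intro (fun w => weight s m = w) _ erefl; move=> ->.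
    by rewrite u20 !mul0r !addr0 subr0 !mul1r; apply: torus_point_congr; right.
  have u1E : u1 = 1.
    rewrite /u1; apply: min_r; move: u20; rewrite /u2; case: (leP (1 - 2 * u) 0); last lra.
    by rewrite eqxx.
  rewrite u1E !mul1r; have E x y : x + (y - x) = y :> R by ring.
  have [[_ ->]|[_ ->]] := weight_edge ad s1; rewrite !E.
    by apply: torus_point_congr; [right; rewrite !angle1E'|left].
  by apply: torus_point_congr; [left|right; rewrite !angle2E'].
Qed.

End TorusKnot.

(** * Continuity of the maps on the knot complement *)

Section DeformContinuity.
Context (R : realType) (n : nat).
Local Notation params := (R * R * R)%type.

Lemma at_weight (T : topologicalType) (x : T) (f g : T -> R) :
  admissible (f x) (g x) -> {for x, continuous f} -> {for x, continuous g} ->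
  {for x, continuous (fun y => weight (f y) (g y))}.
Proof.
move=> ad cf cg; have d0 := upper_lower_gt0 ad.
have cu : {for x, continuous (fun y => upper (f y) (g y))}.
  by rewrite /upper; at_tac.
have cl : {for x, continuous (fun y => lower (f y) (g y))}.
  by rewrite /lower; at_tac.
rewrite /weight; apply: atM => //; apply: atV; first by rewrite gt_eqF.
exact: atD.
Qed.

Lemma at_slide (T : topologicalType) (x : T) (f g h : T -> R) :
  {for x, continuous f} -> {for x, continuous g} -> {for x, continuous h} ->
  {for x, continuous (fun y => slide n (f y) (g y) (h y))}.
Proof. by move=> cf cg ch; rewrite /slide; at_tac. Qed.

Lemma at_params (p : params) :
  [/\ {for p, continuous (fun q : params => q.1.1)},
      {for p, continuous (fun q : params => q.1.2)} &
      {for p, continuous (fun q : params => q.2)}].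
Proof.
split; last exact: cvg_snd.
- by apply: (@continuous_comp _ _ _ (@fst (R * R)%type R) fst); exact: cvg_fst.
- by apply: (@continuous_comp _ _ _ (@fst (R * R)%type R) snd);
    [exact: cvg_fst|exact: cvg_snd].
Qed.

Lemma at_core_torus (p : params) : off_knot p ->
  {for p, continuous (fun q => points (core_lift n (to_core n q).1 (to_core n q).2))}.
Proof.
move=> ad; have [ct cs cm] := at_params p.
have cw : {for p, continuous (fun q : params => weight q.1.2 q.2)} by apply: at_weight.
apply: (@at_points R n params) => i; apply: at_core => //=.
  by have /andP[] := weight_bounds ad.
exact: at_slide.
Qed.

Lemma at_deform (p : params) (u : R) : off_knot p ->
  {for (p, u), continuous (fun q : params * R => torus_point n (deform n q.1 q.2))}.
Proof.
move=> ad; have [ct cs cm] := at_params p.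
have c1 : {for (p, u), continuous (@fst params R)} by exact: cvg_fst.
have c2 : {for (p, u), continuous (@snd params R)} by exact: cvg_snd.
have dt : {for (p, u), continuous (fun q : params * R => q.1.1.1)}.
  by apply: (@continuous_comp _ _ _ (@fst params R) (fun p => p.1.1)).
have ds : {for (p, u), continuous (fun q : params * R => q.1.1.2)}.
  by apply: (@continuous_comp _ _ _ (@fst params R) (fun p => p.1.2)).
have dm : {for (p, u), continuous (fun q : params * R => q.1.2)}.
  by apply: (@continuous_comp _ _ _ (@fst params R) (fun p => p.2)).
have dw : {for (p, u), continuous (fun q : params * R => weight q.1.1.2 q.1.2)}.
  exact: at_weight.
have dl : {for (p, u), continuous
    (fun q : params * R => slide n q.1.1.1 q.1.1.2 (weight q.1.1.2 q.1.2))}.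
  exact: at_slide.
have du : {for (p, u), continuous (fun q : params * R => Num.min (2 * (1 - q.2)) 1)}.
  by at_tac.
have dv : {for (p, u), continuous (fun q : params * R => Num.max (1 - 2 * q.2) 0)}.
  by at_tac.
rewrite /deform /to_core /=; apply: at_torus_point.
    exact: atD dt (atM dv (atD dl (atN dt))).
  by apply: atM => //; apply: atD; [exact: at_cst|exact: atN].
exact: atD dm (atM du (atD dw (atN dm))).
Qed.

End DeformContinuity.

(** * The homotopy equivalence *)

Lemma onem_in01 (R : realFieldType) (u : R) : 0 <= u <= 1 -> 0 <= 1 - u <= 1.
Proof. by move=> u01; lra. Qed.

Section Homeomorphisms.
Context (R : realType).

Lemma homotopy_equivalent_homeo (X Y Z : topologicalType) (h : Y -> Z) :
  homotopy_equivalent R X Y -> homeomorphism h -> homotopy_equivalent R X Z.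
Proof.
move=> [f [g [cf cg [H [cH H0 H1]] [G [cG G0 G1]]]]] [k [ch ck hK kK]].
exists (h \o f), (g \o k); split.
- by move=> x; apply: continuous_comp; [exact: cf|exact: ch].
- by move=> x; apply: continuous_comp; [exact: ck|exact: cg].
- by exists H; split=> // x t t0; rewrite H0 //= hK.
exists (fun zt => h (G (k zt.1, zt.2))); split.
- move=> [z t]; apply: (at_comp ch); apply: (at_comp cG); apply: at_pair.
    by apply: (at_comp ck); exact: cvg_fst.
  exact: cvg_snd.
- by move=> z t t0 /=; rewrite G0.
- by move=> z t t1 /=; rewrite G1 //= kK.
Qed.

Lemma homeomorphism_setC (S : topologicalType) (h : S -> S) (A : set S) :
  homeomorphism h ->
  exists h2 : set_type (~` A) -> set_type (~` (h @` A)), homeomorphism h2.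
Proof.
move=> [k [ch ck hK kK]].
have hA (a : set_type (~` A)) : (~` (h @` A)) (h (\val a)).
  move=> [b Ab] /(can_inj hK) ba; have : (~` A) (\val a) by exact: set_mem (valP a).
  by rewrite -ba.
have kA (a : set_type (~` (h @` A))) : (~` A) (k (\val a)).
  move=> Ak; have : (~` (h @` A)) (\val a) by exact: set_mem (valP a).
  by apply; exists (k (\val a)).
exists (fun a => set_mk (hA a)), (fun a => set_mk (kA a)); split.
- move=> a; apply: set_type_continuous => /=.
  by apply: (at_comp ch); exact: val_continuous.
- move=> a; apply: set_type_continuous => /=.
  by apply: (at_comp ck); exact: val_continuous.
- by move=> a; apply: val_inj => /=; rewrite hK.
- by move=> a; apply: val_inj => /=; rewrite kK.
Qed.

Lemma presents_surj (T S : topologicalType) (q : T -> S) (D : set T) (V : set S)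
  (s : set_type V) : presents q D V -> exists2 p, D p & q p = \val s.
Proof.
move=> [_ _ [K [_ KD Ks]]]; have Vs := set_mem (valP s).
by have [p Kp qp] := Ks _ Vs; exists p => //; apply: KD => //; rewrite qp.
Qed.

End Homeomorphisms.

(** Both maps pass through the mapping cylinder: a configuration goes to the point
of the segment s = 0 with its base angle and ratio, and a point off the knot goes
to the core configuration of its image under to_core.  One composite is the core
configuration, to which core_segment leads; the other one is the start of deform. *)
Lemma standard_torus_knot_complement (R : realType) (n : nat) :
  homotopy_equivalent R (set_type (~` exp_sub n.+2 n (sphere R 1)))
    (set_type (~` standard_torus_knot (R := R) n.+1 n.+2)).
Proof.
have prX := points_presents R n; have prY := torus_point_presents R n.
have [_ DX _] := prX; have [_ DY _] := prY.
have hX : hausdorff_space (exp_space n.+2 (sphere R 1)).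
  by apply: exp_hausdorff => //; exact: sphere_hausdorff.
have hY := @sphere_hausdorff R 3.
have adm (l : R) : 0 <= l <= 1 -> admissible 0 l.
  by move=> l01; split; rewrite ?normr0 //; case=> /eqP; rewrite eq_sym oner_eq0.
pose q0 : prod_topology (fun _ : 'I_n.+2 => R) := fun=> 0.
pose p0 : R * R * R := (0, 0, 0).
have chf (x : prod_topology (fun _ : 'I_n.+2 => R)) : balanced x ->
    {for x, continuous (fun x => torus_point n (base_angle x, 0, gap_ratio x))}.
  move=> bx; apply: at_torus_point; first exact: at_base_angle.
    exact: at_cst.
  exact: at_gap_ratio.
have [f cf fE] := @presented_map _ _ _ _ _ _
  (fun x => torus_point n (base_angle x, 0, gap_ratio x))
  (~` standard_torus_knot (R := R) n.+1 n.+2)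
  q0 hX prX
  (fun x x' bx bx' E => torus_point_core_eq (core_eq_of_points bx bx' E))
  chf
  (fun x bx => DY (base_angle x, 0, gap_ratio x) (adm _ (gap_ratio_bounds bx))).
have [g cg gE] := @presented_map _ _ _ _ _ _
  (fun p => points (core_lift n (to_core n p).1 (to_core n p).2))
  (~` exp_sub n.+2 n (sphere R 1)) p0 hY prY
  (fun p p' ad ad' E => core_points_eq (to_core_eq ad ad' E))
  (@at_core_torus R n)
  (fun p ad => DX _ (core_balanced _ (weight_bounds ad))).
exists f, g; split=> //.
  have chX (x : prod_topology (fun _ : 'I_n.+2 => R)) (u : R) : balanced x ->
      {for (x, u), continuous (fun xu : prod_topology (fun _ : 'I_n.+2 => R) * R =>
        points (core_segment xu.1 (1 - xu.2)))}.
    move=> bx; pose r (xu : prod_topology (fun _ : 'I_n.+2 => R) * R) := (xu.1, 1 - xu.2).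
    apply: (@continuous_comp _ _ _ r (fun xu : prod_topology (fun _ : 'I_n.+2 => R) * R =>
      points (core_segment xu.1 xu.2))).
      apply: at_pair; first exact: cvg_fst.
      by apply: atD; [exact: at_cst|apply: atN; exact: cvg_snd].
    exact: at_core_segment.
  have [H cH HE] := @presented_homotopy R _ _ _ _ _ _
    (fun xu : prod_topology (fun _ : 'I_n.+2 => R) * R =>
      points (core_segment xu.1 (1 - xu.2)))
    (~` exp_sub n.+2 n (sphere R 1))
    q0 hX prX
    (fun x x' u _ bx bx' E => core_segment_points_eq (1 - u) bx bx' E) chX
    (fun x u u01 bx => DX _ (core_segment_balanced bx (onem_in01 u01))).
  exists H; split=> // s t tE; have [x bx xs] := presents_surj s prX;
    apply: val_inj; rewrite (HE x) //= tE.
    have l01 := gap_ratio_bounds bx.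
    have fs : torus_point n (base_angle x, 0, gap_ratio x) = \val (f s) by rewrite (fE x).
    rewrite (gE (base_angle x, 0, gap_ratio x) (f s) (adm _ l01) fs).
    rewrite subr0 /to_core /= weight_middle // /slide mulr0 mul0r addr0.
    by congr points; apply/funext => i; rewrite /core_segment subrr mul0r mul1r add0r.
  rewrite subrr -xs; congr points; apply/funext => i.
  by rewrite /core_segment subr0 mul0r mul1r addr0.
have [H cH HE] := @presented_homotopy R _ _ _ _ _ _
  (fun pu : (R * R * R) * R => torus_point n (deform n pu.1 pu.2))
  (~` standard_torus_knot (R := R) n.+1 n.+2)
  p0 hY prY
  (fun p p' u u01 ad ad' E => deform_eq u01 ad ad' E) (@at_deform R n)
  (fun p u u01 ad => DY _ (deform_off_knot n u01 ad)).
exists H; split=> // s t tE; have [p ad ps] := presents_surj s prY;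
  apply: val_inj; rewrite (HE p) //= tE ?deform1 // deform0.
have w01 := weight_bounds ad.
have gs : points (core_lift n (to_core n p).1 (to_core n p).2) = \val (g s) by rewrite (gE p).
by rewrite (fE _ (g s) (core_balanced _ w01) gs) base_angle_core ?gap_ratio_core.
Qed.

Theorem theorem6 (R : realType) (k : nat) (K : set (sphere R 3)) :
  (2 <= k)%N ->
  is_torus_knot k.-1 k K ->
  homotopy_equivalent R
    (set_type (~` exp_sub k (k - 2) (sphere R 1))) (set_type (~` K)).
Proof.
case: k => [|[|n]] // _ [H [_ homeoH _ H1]].
have one_in : [set` `[0%R : R, 1%R]] 1 by rewrite /= in_itv /= ler01 lexx.
have <- := H1 (set_mk one_in) erefl.
have [h homeoh] := homeomorphism_setC (standard_torus_knot n.+1 n.+2) 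
  (homeoH (set_mk one_in)).
apply: homotopy_equivalent_homeo homeoh.
by rewrite subSS subSS subn0; exact: standard_torus_knot_complement.
Qed.
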